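(* Let $f:\mathbb{R}^n\to\mathbb{R}$ and $x_0\in\mathbb{R}^n$. Suppose that the level set $\mathcal{L}_f(x_0)=\{x : f(x)\le f(x_0)\}$ is compact, and that $f$ is twice uniformly Lipschitz continuously differentiable on an open neighborhood of $\mathcal{L}_f(x_0)$ that includes the trial points generated by the Damped Newton-CG algorithm (described in the context) started at $x_0$, with $L_H$ a Lipschitz constant of $\nabla^2 f$ on this neighborhood. Let $f_{\mathrm{low}}$ be a lower bound of $f$ on $\mathcal{L}_f(x_0)$. Let $\epsilon_g>0$, $\epsilon_H\in(0,1)$, $\theta,\zeta\in(0,1)$, $\eta>0$ be the parameters of the algorithm, and define $$c_{sol} = \frac{\eta}{6}\min\left\{ \left[ \frac{4}{\sqrt{(4+\zeta)^2+8 L_H}+4+\zeta}\right]^3, \left[ \frac{3\theta^2 (1-\zeta) }{L_H+\eta}\right]^3\right\},\qquad c_{nc} = \frac{\eta}{6}\min\left\{1,\frac{27\theta^3}{(L_H+\eta)^3}\right\},$$ $$\bar{K}_1 := \left\lceil \frac{f(x_0)-f_{\mathrm{low}}}{\min\{c_{sol},c_{nc}\}}\max\left\{\epsilon_g^{-3}\epsilon_H^3,\epsilon_H^{-3}\right\} \right\rceil .$$ Then some iterate $x_k$, $k\in\{0,1,\dots,\bar{K}_1+1\}$, generated by the Damped Newton-CG algorithm satisfies $\|\nabla f(x_k)\|\le \epsilon_g$.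
   Context: $\|\cdot\|$ is the Euclidean norm (or induced matrix norm); $\lambda_{\min}$ is the smallest eigenvalue; $\mathrm{sgn}(0)=1$. Capped CG. Inputs: symmetric $H\in\mathbb{R}^{n\times n}$, $g\ne 0$, damping $\epsilon\in(0,1)$, accuracy $\zeta\in(0,1)$, optional scalar $M\ge 0$ (set to $0$ if not provided). Let $\bar H=H+2\epsilon I$. At any time, $\kappa=\frac{M+2\epsilon}{\epsilon}$, $\hat\zeta=\frac{\zeta}{3\kappa}$, $\tau=\frac{\sqrt\kappa}{\sqrt\kappa+1}$, $T=\frac{4\kappa^4}{(1-\sqrt\tau)^2}$ are computed from the current $M$. ''Update $M$ with $u$'' means: if $\|Hu\|>M\|u\|$, replace $M$ by $\|Hu\|/\|u\|$ and recompute $\kappa,\hat\zeta,\tau,T$. Start with $y_0=0$, $r_0=g$, $p_0=-g$, $j=0$. If $p_0^\top\bar Hp_0<\epsilon\|p_0\|^2$, return $d=p_0$ with d_type=NC; otherwise update $M$ with $p_0$. Then repeat: set $\alpha_j=r_j^\top r_j/p_j^\top\bar Hp_j$, $y_{j+1}=y_j+\alpha_jp_j$, $r_{j+1}=r_j+\alpha_j\bar Hp_j$, $\beta_{j+1}=r_{j+1}^\top r_{j+1}/r_j^\top r_j$, $p_{j+1}=-r_{j+1}+\beta_{j+1}p_j$; increase $j$ by $1$; update $M$ with $p_j$, then with $y_j$, then with $r_j$; then apply the tests in order: (1) if $y_j^\top\bar Hy_j<\epsilon\|y_j\|^2$, return $d=y_j$, d_type=NC; (2) else if $\|r_j\|\le\hat\zeta\|r_0\|$,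 return $d=y_j$, d_type=SOL; (3) else if $p_j^\top\bar Hp_j<\epsilon\|p_j\|^2$, return $d=p_j$, d_type=NC; (4) else if $\|r_j\|>\sqrt T\tau^{j/2}\|r_0\|$, compute $\alpha_j=r_j^\top r_j/p_j^\top\bar Hp_j$ and $y_{j+1}=y_j+\alpha_jp_j$, find $i\in\{0,\dots,j-1\}$ with $(y_{j+1}-y_i)^\top\bar H(y_{j+1}-y_i)<\epsilon\|y_{j+1}-y_i\|^2$, and return $d=y_{j+1}-y_i$, d_type=NC. Minimum Eigenvalue Oracle. Inputs: symmetric $H$, tolerance $\epsilon>0$, optional bound $M$ on $\|H\|$. Output: either $\lambda\le-\epsilon/2$ and a vector $v$ with $\|v\|=1$, $v^\top Hv=\lambda$; or a certificate that $\lambda_{\min}(H)\ge-\epsilon$, which is false with probability $\delta$ for some $\delta\in[0,1)$. Damped Newton-CG. Inputs: $\epsilon_g>0$, $\epsilon_H\in(0,1)$, $\theta\in(0,1)$, $\zeta\in(0,1)$, $\eta>0$, starting point $x_0$, optional upper bound $M>0$ on the Hessian norm. For $k=0,1,2,\dots$: - If $\|\nabla f(x_k)\|>\epsilon_g$: call Capped CG with $H=\nabla^2f(x_k)$, $\epsilon=\epsilon_H$, $g=\nabla f(x_k)$, accuracy $\zeta$ (and $M$ if provided) to get $d$, d_type. If d_type=NC, set $d_k=-\mathrm{sgn}(d^\top g)\frac{|d^\top\nabla^2f(x_k)d|}{\|d\|^2}\frac{d}{\|d\|}$; if d_type=SOL, set $d_k=d$. - Otherwise call the Minimum Eigenvalue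 Oracle with $H=\nabla^2f(x_k)$, $\epsilon=\epsilon_H$ (and $M$ if provided). If it certifies $\lambda_{\min}(\nabla^2f(x_k))\ge-\epsilon_H$, terminate; else, with $v$ its output and $g=\nabla f(x_k)$, set $d_k=-\mathrm{sgn}(v^\top g)\frac{|v^\top\nabla^2f(x_k)v|}{\|v\|^2}v$. - Line search: $\alpha_k=\theta^{j_k}$ with $j_k$ the smallest nonnegative integer such that $f(x_k+\alpha_kd_k)<f(x_k)-\frac{\eta}{6}\alpha_k^3\|d_k\|^3$; set $x_{k+1}=x_k+\alpha_kd_k$. *)

(* Defs.v *)
(* R^n is 'cV[R]_n for an arbitrary realType R. *)
From HB Require Import structures.
From mathcomp Require Import all_boot all_order all_algebra.
From mathcomp Require Import all_classical all_reals all_analysis.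
Import Order.TTheory GRing.Theory Num.Theory.
Import numFieldNormedType.Exports.

Set Implicit Arguments.
Unset Strict Implicit.
Unset Printing Implicit Defensive.

Local Open Scope classical_set_scope.
Local Open Scope ring_scope.

Definition dot (R : realType) (n : nat) (u v : 'cV[R]_n) : R :=
  \sum_(i < n) u i 0 * v i 0.

(* The library norm `|u| on matrices is the maximum of the entries; the
   Euclidean norm has to be defined separately. Both induce the same topology. *)
Definition norm2 (R : realType) (n : nat) (u : 'cV[R]_n) : R :=
  Num.sqrt (dot u u).

(* The ball rather than the sphere, so that the set is nonempty for n = 0. *)
Definition opnorm (R : realType) (n : nat) (A : 'M[R]_n) : R :=
  sup [set norm2 (A *m u) | u in [set u : 'cV[R]_n | norm2 u <= 1]].

Definition quad (R : realType) (n : nat) (A : 'M[R]_n) (u : 'cV[R]_n) : R :=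
  dot u (A *m u).

(* Num.sg is 0 at 0; here the sign of 0 is 1. *)
Definition sgn1 (R : realType) (a : R) : R := if 0 <= a then 1 else -1.

Definition grad (R : realType) (n : nat) (f : 'cV[R]_n -> R) (x : 'cV[R]_n) :
    'cV[R]_n :=
  \col_(i < n) 'D_(delta_mx i 0 : 'cV[R]_n) f x.

Definition hess (R : realType) (n : nat) (f : 'cV[R]_n -> R) (x : 'cV[R]_n) :
    'M[R]_n :=
  \matrix_(i < n, j < n)
    'D_(delta_mx j 0 : 'cV[R]_n) (fun z : 'cV[R]_n => grad f z i 0) x.

(* Continuity of the Hessian is part of the Lipschitz bound. *)
Definition lipschitz_C2_on (R : realType) (n : nat) (U : set 'cV[R]_n)
    (L : R) (f : 'cV[R]_n -> R) : Prop :=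
  [/\ forall x, U x -> differentiable f x,
      forall x, U x -> differentiable (grad f) x
    & forall x y, U x -> U y ->
        opnorm (hess f x - hess f y) <= L * norm2 (x - y)].

Inductive d_type : Set := NC | SOL.

Definition damped (R : realType) (n : nat) (H : 'M[R]_n) (eps : R) : 'M[R]_n :=
  H + (2 * eps)%:M.

Definition low_curv (R : realType) (n : nat) (H : 'M[R]_n) (eps : R)
    (u : 'cV[R]_n) : bool :=
  quad (damped H eps) u < eps * norm2 u ^+ 2.

Definition cg_kappa (R : realType) (eps M : R) : R := (M + 2 * eps) / eps.

Definition cg_zetahat (R : realType) (eps zeta M : R) : R :=
  zeta / (3 * cg_kappa eps M).

Definition cg_tau (R : realType) (eps M : R) : R :=
  Num.sqrt (cg_kappa eps M) / (Num.sqrt (cg_kappa eps M) + 1).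

Definition cg_T (R : realType) (eps M : R) : R :=
  4 * cg_kappa eps M ^+ 4 / (1 - Num.sqrt (cg_tau eps M)) ^+ 2.

Definition updM (R : realType) (n : nat) (H : 'M[R]_n) (M : R) (u : 'cV[R]_n) :
    R :=
  if M * norm2 u < norm2 (H *m u) then norm2 (H *m u) / norm2 u else M.

Record cg_state (R : realType) (n : nat) := CGState
  { cg_y : 'cV[R]_n ; cg_r : 'cV[R]_n ; cg_p : 'cV[R]_n ; cg_M : R }.

Definition cg_init (R : realType) (n : nat) (H : 'M[R]_n) (g : 'cV[R]_n)
    (M : R) : cg_state R n :=
  CGState 0 g (- g) (updM H M (- g)).

Definition cg_step (R : realType) (n : nat) (H : 'M[R]_n) (eps : R)
    (s : cg_state R n) : cg_state R n :=
  let Hb := damped H eps in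
  let a := dot (cg_r s) (cg_r s) / quad Hb (cg_p s) in
  let y := cg_y s + a *: cg_p s in
  let r := cg_r s + a *: (Hb *m cg_p s) in
  let b := dot r r / dot (cg_r s) (cg_r s) in
  let p := - r + b *: cg_p s in
  CGState y r p (updM H (updM H (updM H (cg_M s) p) y) r).

(* The state at counter j, computed without regard to the stopping tests;
   it is a state of the algorithm only as long as no earlier test fires. *)
Definition cg_at (R : realType) (n : nat) (H : 'M[R]_n) (g : 'cV[R]_n)
    (eps M : R) (j : nat) : cg_state R n :=
  iter j (cg_step H eps) (cg_init H g M).

Definition cg_test1 (R : realType) (n : nat) (H : 'M[R]_n) (g : 'cV[R]_n)
    (eps M : R) (j : nat) : bool :=
  low_curv H eps (cg_y (cg_at H g eps M j)).

Definition cg_test2 (R : realType) (n : nat) (H : 'M[R]_n) (g : 'cV[R]_n)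
    (eps zeta M : R) (j : nat) : bool :=
  let s := cg_at H g eps M j in
  norm2 (cg_r s) <= cg_zetahat eps zeta (cg_M s) * norm2 g.

Definition cg_test3 (R : realType) (n : nat) (H : 'M[R]_n) (g : 'cV[R]_n)
    (eps M : R) (j : nat) : bool :=
  low_curv H eps (cg_p (cg_at H g eps M j)).

Definition cg_test4 (R : realType) (n : nat) (H : 'M[R]_n) (g : 'cV[R]_n)
    (eps M : R) (j : nat) : bool :=
  let s := cg_at H g eps M j in
  Num.sqrt (cg_T eps (cg_M s)) * cg_tau eps (cg_M s) `^ (j%:R / 2) * norm2 g
    < norm2 (cg_r s).

(* The loop body with counter j is entered and its tests are evaluated. *)
Definition cg_reach (R : realType) (n : nat) (H : 'M[R]_n) (g : 'cV[R]_n)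
    (eps zeta M : R) (j : nat) : Prop :=
  [/\ (0 < j)%N,
      ~~ low_curv H eps (- g)
    & forall l : nat, (0 < l < j)%N ->
        [&& ~~ cg_test1 H g eps M l, ~~ cg_test2 H g eps zeta M l,
            ~~ cg_test3 H g eps M l & ~~ cg_test4 H g eps M l]].

(* capped_cg H g eps zeta M d t : the call may return (d, t). The only
   freedom is the index i in the last case. *)
Inductive capped_cg (R : realType) (n : nat) (H : 'M[R]_n) (g : 'cV[R]_n)
    (eps zeta M : R) : 'cV[R]_n -> d_type -> Prop :=
| CG_p0 : low_curv H eps (- g) -> capped_cg H g eps zeta M (- g) NC
| CG_y j : cg_reach H g eps zeta M j ->
    cg_test1 H g eps M j ->
    capped_cg H g eps zeta M (cg_y (cg_at H g eps M j)) NC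
| CG_sol j : cg_reach H g eps zeta M j ->
    ~~ cg_test1 H g eps M j ->
    cg_test2 H g eps zeta M j ->
    capped_cg H g eps zeta M (cg_y (cg_at H g eps M j)) SOL
| CG_p j : cg_reach H g eps zeta M j ->
    ~~ cg_test1 H g eps M j -> ~~ cg_test2 H g eps zeta M j ->
    cg_test3 H g eps M j ->
    capped_cg H g eps zeta M (cg_p (cg_at H g eps M j)) NC
| CG_slow j i : cg_reach H g eps zeta M j ->
    ~~ cg_test1 H g eps M j -> ~~ cg_test2 H g eps zeta M j ->
    ~~ cg_test3 H g eps M j ->
    cg_test4 H g eps M j ->
    (i < j)%N ->
    low_curv H eps (cg_y (cg_at H g eps M j.+1) - cg_y (cg_at H g eps M i)) ->
    capped_cg H g eps zeta M
      (cg_y (cg_at H g eps M j.+1) - cg_y (cg_at H g eps M i)) NC.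

(* Some v is a direction of negative curvature; None is the certificate
   lambda_min(H) >= - eps. The oracle is randomized and the certificate may be
   wrong, so None is a possible answer for every H: what is proved for all
   answers allowed here holds for every realization of the randomness. *)
Inductive eig_oracle (R : realType) (n : nat) (H : 'M[R]_n) (eps : R) :
    option 'cV[R]_n -> Prop :=
| Oracle_dir lam v : lam <= - (eps / 2) -> norm2 v = 1 -> quad H v = lam ->
    eig_oracle H eps (Some v)
| Oracle_cert : eig_oracle H eps None.

Inductive newton_dir (R : realType) (n : nat) (f : 'cV[R]_n -> R)
    (eps_g eps_H zeta : R) (M : option R) (x : 'cV[R]_n) : 'cV[R]_n -> Prop :=
| Dir_cg_nc d : eps_g < norm2 (grad f x) ->
    capped_cg (hess f x) (grad f x) eps_H zeta (odflt 0 M) d NC ->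
    newton_dir f eps_g eps_H zeta M x
      (- (sgn1 (dot d (grad f x)) * (`|quad (hess f x) d| / norm2 d ^+ 2))
         *: ((norm2 d)^-1 *: d))
| Dir_cg_sol d : eps_g < norm2 (grad f x) ->
    capped_cg (hess f x) (grad f x) eps_H zeta (odflt 0 M) d SOL ->
    newton_dir f eps_g eps_H zeta M x d
| Dir_oracle v : norm2 (grad f x) <= eps_g ->
    eig_oracle (hess f x) eps_H (Some v) ->
    newton_dir f eps_g eps_H zeta M x
      (- (sgn1 (dot v (grad f x)) * (`|quad (hess f x) v| / norm2 v ^+ 2))
         *: v).

Definition decrease (R : realType) (n : nat) (f : 'cV[R]_n -> R)
    (eta : R) (x d : 'cV[R]_n) (a : R) : bool :=
  f (x + a *: d) < f x - eta / 6 * a ^+ 3 * norm2 d ^+ 3.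

Definition line_search (R : realType) (n : nat) (f : 'cV[R]_n -> R)
    (theta eta : R) (x d : 'cV[R]_n) (j : nat) : Prop :=
  decrease f eta x d (theta ^+ j) /\
  forall i : nat, (i < j)%N -> ~~ decrease f eta x d (theta ^+ i).

(* The points at which the line search from x along d evaluates f. *)
Definition trial_point (R : realType) (n : nat) (f : 'cV[R]_n -> R)
    (theta eta : R) (x d z : 'cV[R]_n) : Prop :=
  exists2 j : nat, forall i : nat, (i < j)%N -> ~~ decrease f eta x d (theta ^+ i)
    & z = x + theta ^+ j *: d.

(* newton_iter ... x od ox : the iteration from x computes the direction od
   (None if there is none) and moves to ox (None if there is no next iterate).
   The last two cases describe a breakdown: a line search that backtracks for
   ever, and a Capped CG call that returns nothing. They are not excluded by
   definition, so a statement about all runs has to rule them out. *)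
Inductive newton_iter (R : realType) (n : nat) (f : 'cV[R]_n -> R)
    (eps_g eps_H theta zeta eta : R) (M : option R) (x : 'cV[R]_n) :
    option 'cV[R]_n -> option 'cV[R]_n -> Prop :=
| Iter_stop : norm2 (grad f x) <= eps_g ->
    eig_oracle (hess f x) eps_H None ->
    newton_iter f eps_g eps_H theta zeta eta M x None None
| Iter_step d j : newton_dir f eps_g eps_H zeta M x d ->
    line_search f theta eta x d j ->
    newton_iter f eps_g eps_H theta zeta eta M x
      (Some d) (Some (x + theta ^+ j *: d))
| Iter_ls_fail d : newton_dir f eps_g eps_H zeta M x d ->
    (forall j : nat, ~ line_search f theta eta x d j) ->
    newton_iter f eps_g eps_H theta zeta eta M x (Some d) None
| Iter_cg_fail : eps_g < norm2 (grad f x) ->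
    (forall d t,
       ~ capped_cg (hess f x) (grad f x) eps_H zeta (odflt 0 M) d t) ->
    newton_iter f eps_g eps_H theta zeta eta M x None None.

(* xs k = Some x when x is the k-th iterate, None when the run is already over;
   ds k is the direction computed at iteration k, if any. *)
Definition newton_run (R : realType) (n : nat) (f : 'cV[R]_n -> R)
    (eps_g eps_H theta zeta eta : R) (M : option R) (x0 : 'cV[R]_n)
    (xs ds : nat -> option 'cV[R]_n) : Prop :=
  xs 0%N = Some x0 /\
  forall k : nat,
    if xs k is Some x
    then newton_iter f eps_g eps_H theta zeta eta M x (ds k) (xs k.+1)
    else ds k = None /\ xs k.+1 = None.

Definition c_sol (R : realType) (L theta zeta eta : R) : R :=
  eta / 6 *
  Num.min ((4 / (Num.sqrt ((4 + zeta) ^+ 2 + 8 * L) + 4 + zeta)) ^+ 3)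
          ((3 * theta ^+ 2 * (1 - zeta) / (L + eta)) ^+ 3).

Definition c_nc (R : realType) (L theta eta : R) : R :=
  eta / 6 * Num.min 1 (27 * theta ^+ 3 / (L + eta) ^+ 3).

Definition K1 (R : realType) (L theta zeta eta eps_g eps_H f0 flow : R) : int :=
  Num.ceil ((f0 - flow) / Num.min (c_sol L theta zeta eta) (c_nc L theta eta)
            * Num.max (eps_g ^- 3 * eps_H ^+ 3) (eps_H ^- 3)).

(* Main.v *)
Require Import Defs.
From HB Require Import structures.
From mathcomp Require Import all_boot all_order all_algebra.
From mathcomp Require Import all_classical all_reals all_analysis.
From mathcomp Require Import ring lra.
Import Order.TTheory GRing.Theory Num.Theory.
Import numFieldNormedType.Exports.
Local Open Scope classical_set_scope.
Local Open Scope ring_scope.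

(** Put [m = min (eps_g / eps_H) eps_H] and [c = min c_sol c_nc]. An iteration
    from a point of the level set with a gradient longer than [eps_g] always
    yields a next iterate, and decreases [f] by at least [c m ^ 3] if the
    gradient is still longer than [eps_g] there ([newton_iter_progress]). Since
    [f] is at least [f_low] on the level set and the maximum in [K1] is
    [m ^ -3], this cannot happen [K1 + 1] times in a row.

    The first claim needs that Capped CG returns ([capped_cg_returns]). While no
    test fires the residuals are nonzero and mutually orthogonal, so that some
    test fires within [n] steps; the danger is the last test, which fires but
    might find no direction of low curvature. That it finds one is
    [cg_slow_convergence], which rests on [cg_linear_rate]: if all differences
    between the last iterate and the earlier ones had curvature at least [eps],
    conjugate gradients would converge at the accelerated rate
    [tau = 1 - 1 / (sqrt kappa + 1)], and the test would not have fired.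
    Acceleration is proved with an estimate sequence: quadratic models
    [est j], convex combinations of lower bounds of the quadratic objective,
    whose minimum stays above the objective at the [j]-th iterate
    ([obj_le_est_min]) while their excess over the objective at the last iterate
    shrinks by [tau] at each step ([est_contract]). Orthogonality of the
    residuals removes the cross terms, so that the iterates of conjugate
    gradients need no extrapolation.

    The decrease comes from a cubic Taylor bound. A direction of negative
    curvature is scaled to have length at least [eps_H] and curvature minus its
    length cubed, so that every step shorter than [3 / (L + eta)] decreases [f]
    enough ([nc_decrease]). A direction [d] from an approximate solution
    satisfies [sol_decrease]: every step [a <= 1] with [a ^ 2 * |d| <= q]
    decreases [f] enough, where [q] is proportional to [eps_H]. If [|d| > q],
    the accepted step therefore has [a ^ 2 * |d|] at least [theta ^ 2 * q] and
    cannot be short. If [|d| <= q], the unit step is accepted, and as [d] nearly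
    solves the damped Newton equation, the gradient at the new point can exceed
    [eps_g] only if [d] is long ([sol_unit_step_long]).

    The Taylor bound holds on segments contained in the neighbourhood [U], which
    need not be convex; [descent_segment] shows that a segment along which the
    bound forces [f] not to increase cannot leave the level set. *)

(** * Euclidean inner product and norm *)

Section Euclid.
Context {R : realType} {n : nat}.
Implicit Types (u v w : 'cV[R]_n) (A : 'M[R]_n).

Lemma dotE u v : dot u v = (u^T *m v) 0 0.
Proof. by rewrite mxE; apply: eq_bigr => i _; rewrite mxE. Qed.

Lemma dotC u v : dot u v = dot v u.
Proof. by apply: eq_bigr => i _; rewrite mulrC. Qed.

Lemma dotDr u v w : dot u (v + w) = dot u v + dot u w.
Proof. by rewrite !dotE mulmxDr mxE. Qed.

Lemma dotZr u v (a : R) : dot u (a *: v) = a * dot u v.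
Proof. by rewrite !dotE -scalemxAr mxE. Qed.

Lemma dotNr u v : dot u (- v) = - dot u v.
Proof. by rewrite -scaleN1r dotZr mulN1r. Qed.

Lemma dotBr u v w : dot u (v - w) = dot u v - dot u w.
Proof. by rewrite dotDr dotNr. Qed.

Lemma dot0r u : dot u 0 = 0.
Proof. by rewrite -(scale0r 0) dotZr mul0r. Qed.

Lemma dotDl u v w : dot (u + v) w = dot u w + dot v w.
Proof. by rewrite ![dot _ w]dotC dotDr. Qed.

Lemma dotZl u v (a : R) : dot (a *: u) v = a * dot u v.
Proof. by rewrite ![dot _ v]dotC dotZr. Qed.

Lemma dotNl u v : dot (- u) v = - dot u v.
Proof. by rewrite ![dot _ v]dotC dotNr. Qed.

Lemma dotBl u v w : dot (u - v) w = dot u w - dot v w.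
Proof. by rewrite dotDl dotNl. Qed.

Lemma dot_mulmxl A u v : dot (A *m u) v = dot u (A^T *m v).
Proof. by rewrite !dotE trmx_mul mulmxA. Qed.

Lemma dot_symm A u v : A^T = A -> dot u (A *m v) = dot v (A *m u).
Proof. by move=> sA; rewrite dotC dot_mulmxl sA. Qed.

Lemma dot_ge0 u : 0 <= dot u u.
Proof. by apply: sumr_ge0 => i _; rewrite -expr2 sqr_ge0. Qed.

Lemma dot_eq0 u : dot u u = 0 -> u = 0.
Proof.
move=> /eqP; rewrite psumr_eq0 => [/allP u0|i _]; last by rewrite -expr2 sqr_ge0.
apply/matrixP => i j; rewrite ord1 mxE; apply/eqP.
by have := u0 i (mem_index_enum i); rewrite /= mulf_eq0 orbb.
Qed.

Lemma norm2_ge0 u : 0 <= norm2 u.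
Proof. exact: sqrtr_ge0. Qed.

Lemma norm2_sqr u : norm2 u ^+ 2 = dot u u.
Proof. by rewrite sqr_sqrtr ?dot_ge0. Qed.

Lemma norm2_eq0 u : norm2 u = 0 -> u = 0.
Proof. by move=> u0; apply: dot_eq0; rewrite -norm2_sqr u0 expr0n. Qed.

Lemma norm20 : norm2 (0 : 'cV[R]_n) = 0.
Proof. by rewrite /norm2 dot0r sqrtr0. Qed.

Lemma norm2_gt0 u : u != 0 -> 0 < norm2 u.
Proof.
by move=> u0; rewrite lt_def norm2_ge0 andbT; apply: contra_neq u0 => /norm2_eq0.
Qed.

Lemma norm2Z u (a : R) : norm2 (a *: u) = `|a| * norm2 u.
Proof.
by rewrite /norm2 dotZl dotZr mulrA -expr2 sqrtrM ?sqr_ge0 ?sqrtr_sqr.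
Qed.

Lemma norm2N u : norm2 (- u) = norm2 u.
Proof. by rewrite -scaleN1r norm2Z normrN1 mul1r. Qed.

Lemma CauchySchwarz u v : `|dot u v| <= norm2 u * norm2 v.
Proof.
rewrite -(@ler_pXn2r _ 2%N) ?nnegrE ?mulr_ge0 ?norm2_ge0 ?normr_ge0//.
rewrite exprMn !norm2_sqr real_normK ?num_real//.
have [v0|v0] := eqVneq v 0; first by rewrite v0 !dot0r expr0n/= mulr0.
have vv : 0 < dot v v by rewrite -norm2_sqr exprn_gt0 ?norm2_gt0.
rewrite -(ler_pM2l vv) -subr_ge0.
have := dot_ge0 (dot v v *: u - dot u v *: v).
rewrite !(dotBl, dotBr, dotZl, dotZr) (dotC v u); lra.
Qed.

Lemma dot_le_norm2 u v : dot u v <= norm2 u * norm2 v.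
Proof. exact: le_trans (ler_norm _) (CauchySchwarz u v). Qed.

Lemma norm2D u v : norm2 (u + v) <= norm2 u + norm2 v.
Proof.
rewrite -(@ler_pXn2r _ 2%N) ?nnegrE ?addr_ge0 ?norm2_ge0//.
rewrite sqrrD !norm2_sqr dotDl !dotDr (dotC v u).
have := dot_le_norm2 u v; lra.
Qed.

Lemma norm2B u v : norm2 (u - v) <= norm2 u + norm2 v.
Proof. by rewrite -(norm2N v) norm2D. Qed.

End Euclid.

(** The supremum defining [opnorm] is finite because every entry of [A *m u]
    is bounded by the norm of a row of [A] when [u] is in the unit ball. *)
Lemma norm2_mulmx_le {R : realType} {n : nat} (A : 'M[R]_n) (u : 'cV[R]_n) :
  norm2 (A *m u) <= opnorm A * norm2 u.
Proof.
have rowE i (w : 'cV[R]_n) : (A *m w) i 0 = dot (row i A)^T w.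
  by rewrite mxE; apply: eq_bigr => j _; rewrite !mxE.
have ub : has_ubound
    [set norm2 (A *m w) | w in [set w : 'cV[R]_n | norm2 w <= 1]].
  exists (Num.sqrt (\sum_(i < n) dot (row i A)^T (row i A)^T)) => _ [w /= w1 <-].
  rewrite ler_wsqrtr//; apply: ler_sum => i _.
  rewrite -expr2 rowE -norm2_sqr -real_normK ?num_real//.
  rewrite ler_pXn2r ?nnegrE ?norm2_ge0//.
  apply: le_trans (CauchySchwarz _ _) _.
  by rewrite ler_piMr ?norm2_ge0.
have [->|u0] := eqVneq u 0; first by rewrite mulmx0 norm20 mulr0.
have nu := norm2_gt0 _ u0.
rewrite -ler_pdivrMr// mulrC -[X in X * _]ger0_norm ?invr_ge0 ?norm2_ge0//.
rewrite -norm2Z scalemxAr; apply: (ub_le_sup ub).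
exists ((norm2 u)^-1 *: u) => //=.
by rewrite norm2Z ger0_norm ?invr_ge0 ?norm2_ge0// mulVf// gt_eqF.
Qed.

(** * Conjugate gradients *)

(** The recurrences of conjugate gradients for [B y + g = 0], started at [0]. *)
Record conjugate_gradient {R : realType} {n : nat} (B : 'M[R]_n)
    (g : 'cV[R]_n) (y r p : nat -> 'cV[R]_n) : Prop := {
  cg_y0 : y 0%N = 0;
  cg_r0 : r 0%N = g;
  cg_p0 : p 0%N = - g;
  cg_yS : forall j, y j.+1 = y j + dot (r j) (r j) / quad B (p j) *: p j;
  cg_rS : forall j,
    r j.+1 = r j + dot (r j) (r j) / quad B (p j) *: (B *m p j);
  cg_pS : forall j,
    p j.+1 = - r j.+1 + dot (r j.+1) (r j.+1) / dot (r j) (r j) *: p j }.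

Section ConjugateGradient.
Context {R : realType} {n : nat} (B : 'M[R]_n) (g : 'cV[R]_n)
  (y r p : nat -> 'cV[R]_n) (N : nat).
Hypothesis symB : B^T = B.
Hypothesis cg : conjugate_gradient B g y r p.
Hypothesis ppos : forall l, (l < N)%N -> 0 < quad B (p l).
Hypothesis rpos : forall l, (l < N)%N -> 0 < dot (r l) (r l).

Let alpha j := dot (r j) (r j) / quad B (p j).
Let beta j := dot (r j.+1) (r j.+1) / dot (r j) (r j).
Let y0 : y 0%N = 0. Proof. by case: cg. Qed.
Let r0 : r 0%N = g. Proof. by case: cg. Qed.
Let p0 : p 0%N = - g. Proof. by case: cg. Qed.
Let yS j : y j.+1 = y j + alpha j *: p j. Proof. by case: cg. Qed.
Let rS j : r j.+1 = r j + alpha j *: (B *m p j). Proof. by case: cg. Qed.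
Let pS j : p j.+1 = - r j.+1 + beta j *: p j. Proof. by case: cg. Qed.

Let obj z := quad B z / 2 + dot g z.

Lemma cg_residual j : r j = B *m y j + g.
Proof.
elim: j => [|j IH]; first by rewrite y0 mulmx0 add0r r0.
by rewrite rS yS mulmxDr -scalemxAr IH addrAC.
Qed.

(** The orthogonality of [r (j + 1)] to earlier search directions follows from
    the recurrence and conjugacy; the rest reduces to it, because [r i] is a
    combination of search directions and [B *m p i] is proportional to
    [r (i + 1) - r i]. *)
Lemma cg_orthogonality j : (j <= N)%N ->
  [/\ forall i, (i < j)%N -> dot (r j) (r i) = 0,
      forall i, (i < j)%N -> dot (p j) (B *m p i) = 0,
      forall i, (i < j)%N -> dot (r j) (p i) = 0
    & dot (r j) (p j) = - dot (r j) (r j)].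
Proof.
elim/ltn_ind: j => -[_ _|j IH jN].
  by split=> //; rewrite r0 p0 dotNr.
have [rr pp rp rpj] := IH j (leqnn _) (ltnW jN).
have qj := ppos j jN; have dj := rpos j jN.
have rpS i : (i < j.+1)%N -> dot (r j.+1) (p i) = 0.
  rewrite ltnS leq_eqVlt rS dotDl dotZl [dot (B *m _) _]dotC => /orP[/eqP->|ij].
    by rewrite rpj /alpha/= -/(quad B (p j)) divfK ?gt_eqF// addrC subrr.
  by rewrite rp// (dot_symm _ _ _ symB) pp// mulr0 addr0.
have rrS i : (i < j.+1)%N -> dot (r j.+1) (r i) = 0.
  case: i => [_|i ij].
    by rewrite r0 -[g]opprK -p0 dotNr rpS// oppr0.
  have -> : r i.+1 = beta i *: p i - p i.+1.
    by rewrite pS opprD opprK addrCA subrr addr0.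
  by rewrite dotBr dotZr !rpS// ?mulr0 ?subrr// ltnW.
split=> //; last first.
  by rewrite pS dotDr dotNr dotZr rpS// mulr0 addr0.
move=> i; rewrite ltnS => ij.
have iN : (i < N)%N by exact: leq_ltn_trans ij jN.
have ai : alpha i != 0.
  by rewrite mulf_neq0 ?invr_eq0// gt_eqF ?rpos ?ppos.
have Bp : B *m p i = (alpha i)^-1 *: (r i.+1 - r i).
  by rewrite rS addrAC subrr add0r scalerA mulVf// scale1r.
rewrite pS dotDl dotNl dotZl.
move: ij; rewrite leq_eqVlt => /orP[/eqP ij|ij]; last first.
  by rewrite {1}Bp dotZr dotBr !rrS ?ltnS ?(ltnW ij)// subrr mulr0 pp//
    mulr0 oppr0 addr0.
rewrite {1}Bp dotZr dotBr ij (rrS j)// /alpha /beta invf_div -/(quad B (p j)).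
by field; rewrite !gt_eqF.
Qed.

Lemma cg_residual_perp_iterate i j : (i <= j <= N)%N -> dot (r j) (y i) = 0.
Proof.
move=> /andP[ij jN]; have [_ _ rp _] := cg_orthogonality j jN.
elim: i ij => [|i IH] ij; first by rewrite y0 dot0r.
by rewrite yS dotDr dotZr IH ?(ltnW ij)// rp// mulr0 addr0.
Qed.

(** By conjugacy, the curvatures along the two parts of the decomposition
    [r j = beta p (j - 1) - p j] add up to the curvature along [r j]. *)
Lemma cg_curvature_le j : (j < N)%N -> quad B (p j) <= quad B (r j).
Proof.
case: j => [_|j jN]; first by rewrite /quad p0 r0 mulmxN dotNl dotNr opprK.
have [_ pp _ _] := cg_orthogonality j.+1 (ltnW jN).
have -> : r j.+1 = beta j *: p j - p j.+1.
  by rewrite pS opprD opprK addrCA subrr addr0.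
rewrite /quad mulmxBr -scalemxAr !(dotBl, dotBr, dotZl, dotZr).
have e : dot (p j.+1) (B *m p j) = 0 by rewrite pp.
rewrite (dot_symm _ (p j) (p j.+1) symB) e.
have : 0 <= beta j ^+ 2 * quad B (p j).
  by rewrite mulr_ge0 ?sqr_ge0// ltW// ppos// ltnW.
rewrite /quad; lra.
Qed.

(** The residual is the gradient of the quadratic objective. *)
Lemma obj_expansion j z :
  obj z = obj (y j) + dot (r j) (z - y j) + quad B (z - y j) / 2.
Proof.
rewrite /obj cg_residual /quad mulmxBr !(dotBl, dotBr, dotDl).
rewrite [dot (B *m _) _]dotC [dot (B *m _) _]dotC (dot_symm _ (y j) z symB); lra.
Qed.

Lemma cg_decrease j : (j < N)%N ->
  obj (y j.+1) = obj (y j) - alpha j * dot (r j) (r j) / 2.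
Proof.
move=> jN; have [_ _ _ rpj] := cg_orthogonality j (ltnW jN).
have q0 := ppos j jN.
rewrite (obj_expansion j (y j.+1)) yS [y j + _]addrC addrK /quad.
rewrite -scalemxAr !dotZr dotZl rpj.
have -> : dot (p j) (B *m p j) = dot (r j) (r j) / alpha j.
  by rewrite /alpha -/(quad B (p j)) invf_div mulrC divfK// gt_eqF// rpos.
have : alpha j * (alpha j * (dot (r j) (r j) / alpha j)) = alpha j * dot (r j) (r j).
  by rewrite [_ * (_ / _)]mulrC divfK// gt_eqF// divr_gt0// rpos.
lra.
Qed.

Section Acceleration.
Context (eps kappa tau : R) (J : nat).
Hypothesis NE : N = J.+1.
Hypothesis J0 : (0 < J)%N.
Hypothesis eps0 : 0 < eps.
Hypothesis kappa0 : 0 < kappa.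
Hypothesis tau01 : 0 <= tau <= 1.
Hypothesis tau_kappa : (1 - tau) ^+ 2 * kappa <= 1.
Hypothesis rcurv : forall l, (l <= J)%N ->
  quad B (r l) <= kappa * eps * dot (r l) (r l).
Hypothesis ycurv : forall i, (i < J)%N ->
  eps * norm2 (y J.+1 - y i) ^+ 2 <= quad B (y J.+1 - y i).

(** The [j]-th model is [est_min j + eps / 2 * |z - est_center j| ^ 2]. The
    models start from the objective at [0] plus [eps / 2 * |z| ^ 2], and the next
    one mixes in, with weight [1 - tau], the lower bound of the objective that
    curvature [eps] would give at [y j] (see [estS]). The two recurrences are
    the result of completing the square. *)
Fixpoint est_center j : 'cV[R]_n :=
  if j is i.+1
  then tau *: est_center i + (1 - tau) *: (y i - eps^-1 *: r i) else 0.

Fixpoint est_min j : R :=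
  if j is i.+1
  then tau * est_min i + (1 - tau) * obj (y i)
       + eps / 2 * tau * (1 - tau)
         * dot (y i - est_center i) (y i - est_center i)
       - (1 - tau) ^+ 2 / (2 * eps) * dot (r i) (r i)
  else 0.

Let est j z := est_min j + eps / 2 * dot (z - est_center j) (z - est_center j).

(** The centers lie in the span of the earlier residuals. This is what kills the
    cross term that an accelerated gradient method removes by extrapolation. *)
Lemma est_center_perp i j : (i <= j <= J.+1)%N -> dot (r j) (est_center i) = 0.
Proof.
elim: i => [|i IH] /andP[ij jJ]; first by rewrite dot0r.
have jN : (j <= N)%N by rewrite NE.
have [rr _ _ _] := cg_orthogonality j jN.
rewrite /= dotDr !dotZr dotBr dotZr IH ?(ltnW ij)// rr//.
by rewrite cg_residual_perp_iterate ?(ltnW ij) ?NE// !(mulr0, subr0, addr0).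
Qed.

Lemma estS j z : (j <= J)%N -> est j.+1 z =
  tau * est j z + (1 - tau) * (obj (y j) + dot (r j) (z - y j)
                               + eps / 2 * dot (z - y j) (z - y j)).
Proof.
move=> jJ.
have rv : dot (r j) (est_center j) = 0 by rewrite est_center_perp ?leqnn ?leqW.
have ry : dot (r j) (y j) = 0.
  by rewrite cg_residual_perp_iterate ?leqnn ?NE ?leqW.
rewrite /est /= !(dotDl, dotDr, dotNl, dotNr, dotZl, dotZr).
rewrite (dotC (est_center j) (y j)) (dotC (est_center j) (r j)).
rewrite (dotC (est_center j) z) (dotC (y j) (r j)) (dotC z (y j)) (dotC z (r j)).
by rewrite rv ry; field; rewrite gt_eqF.
Qed.

(** The step length is at least [1 / (kappa eps)], that of a gradient step,
    because the curvature along [p j] is at most the one along [r j]. *)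
Lemma cg_sufficient_decrease j : (j <= J)%N ->
  dot (r j) (r j) / (2 * kappa * eps) <= obj (y j) - obj (y j.+1).
Proof.
move=> jJ; rewrite cg_decrease ?NE// opprB addrCA subrr addr0.
have q0 : 0 < quad B (p j) by rewrite ppos ?NE.
have d0 : 0 < dot (r j) (r j) by rewrite rpos ?NE.
have qle : quad B (p j) <= kappa * eps * dot (r j) (r j).
  by apply: le_trans (rcurv j jJ); rewrite cg_curvature_le ?NE.
have ke : 0 < kappa * eps by rewrite mulr_gt0.
have a_ge : (kappa * eps)^-1 <= alpha j.
  by rewrite /alpha ler_pdivlMr// mulrC ler_pdivrMr// mulrC.
rewrite -mulrA invfM mulrCA mulrC ler_pM2r ?invr_gt0//.
by rewrite mulrC ler_pM2r.
Qed.

(** Passing to the next model costs [(1 - tau) ^ 2 * |r j| ^ 2 / (2 eps)], which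
    the decrease of the objective pays for as [(1 - tau) ^ 2 <= 1 / kappa]. *)
Lemma obj_le_est_min j : (j <= J)%N -> obj (y j) <= est_min j.
Proof.
elim: j => [_|j IH jJ].
  by rewrite /= y0 /obj /quad mulmx0 !dot0r mul0r addr0.
have {}IH := IH (ltnW jJ).
have dec := cg_sufficient_decrease j (ltnW jJ).
have /andP[t0 t1] := tau01.
rewrite [est_min _]/=.
have d0 : 0 < dot (r j) (r j) by rewrite rpos// NE (leqW jJ).
have h1 : tau * obj (y j) <= tau * est_min j by rewrite ler_wpM2l.
have h2 : 0 <= eps / 2 * tau * (1 - tau)
    * dot (y j - est_center j) (y j - est_center j).
  by rewrite !mulr_ge0 ?dot_ge0 ?invr_ge0 ?subr_ge0// ltW.
have h3 : (1 - tau) ^+ 2 / (2 * eps) * dot (r j) (r j)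
          <= dot (r j) (r j) / (2 * kappa * eps).
  rewrite mulrC ler_pM2l// -[leRHS]div1r ler_pdivlMr ?mulr_gt0//.
  have -> : (1 - tau) ^+ 2 / (2 * eps) * (2 * kappa * eps)
            = (1 - tau) ^+ 2 * kappa by field; rewrite gt_eqF.
  by [].
lra.
Qed.

(** At the last iterate, the lower bound mixed in at step [j] is indeed below the
    objective: this is the curvature assumption on [y (J + 1) - y j]. *)
Lemma est_contract j : (j <= J)%N ->
  est j (y J.+1) - obj (y J.+1) <= tau ^+ j * (est 0 (y J.+1) - obj (y J.+1)).
Proof.
have /andP[t0 t1] := tau01.
elim: j => [_|j IH jJ]; first by rewrite expr0 mul1r.
rewrite estS; last exact: ltnW.
have c : obj (y j) + dot (r j) (y J.+1 - y j)
    + eps / 2 * dot (y J.+1 - y j) (y J.+1 - y j) <= obj (y J.+1).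
  rewrite [leRHS](obj_expansion j) lerD2l -norm2_sqr mulrAC.
  by rewrite ler_pM2r ?invr_gt0// ycurv.
have {}IH := ler_wpM2l t0 (IH (ltnW jJ)).
have {}c : (1 - tau) * (obj (y j) + dot (r j) (y J.+1 - y j)
    + eps / 2 * dot (y J.+1 - y j) (y J.+1 - y j)) <= (1 - tau) * obj (y J.+1).
  by rewrite ler_wpM2l// subr_ge0.
rewrite exprS -mulrA; lra.
Qed.

(** The decrease in step [J] bounds [|r J| ^ 2]; on the other side the models
    bound it by [tau ^ J] times the initial gap, which is at most
    [|g| ^ 2 / eps] since curvature [eps] along [y (J + 1)] gives
    [eps |y (J + 1)| <= |g|]. *)
Lemma cg_linear_rate : dot (r J) (r J) <= 2 * kappa * tau ^+ J * dot g g.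
Proof.
have /andP[t0 t1] := tau01.
set Y := y J.+1.
have h1 := cg_sufficient_decrease J (leqnn _).
have h2 := obj_le_est_min J (leqnn _).
have h3 := est_contract J (leqnn _).
have h4 : est_min J <= est J Y.
  by rewrite lerDl mulr_ge0 ?dot_ge0// divr_ge0// ltW.
have gY : dot g Y = - quad B Y.
  have : dot (r J.+1) Y = 0 by rewrite cg_residual_perp_iterate ?NE ?leqnn.
  rewrite cg_residual dotDl dotC -/Y -/(quad B Y); lra.
have cY : eps * norm2 Y ^+ 2 <= quad B Y by have := ycurv 0 J0; rewrite y0 subr0.
have gYle : - dot g Y <= norm2 g * norm2 Y.
  by rewrite -dotNl -(norm2N g) dot_le_norm2.
have nY := norm2_ge0 Y; have ng := norm2_ge0 g.
have bY : eps * norm2 Y <= norm2 g.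
  have [->|Y0] := eqVneq (norm2 Y) 0; first by rewrite mulr0.
  have Y0' : 0 < norm2 Y by rewrite lt_def Y0.
  by rewrite -(ler_pM2r Y0') -mulrA -expr2; lra.
have h5 : est 0 Y - obj Y <= dot g g / eps.
  rewrite /est /= subr0 add0r -norm2_sqr /obj gY ler_pdivlMr// -norm2_sqr.
  have : eps * quad B Y <= norm2 g ^+ 2.
    have : eps * quad B Y <= eps * (norm2 g * norm2 Y).
      by rewrite ler_pM2l//; lra.
    have : norm2 g * (eps * norm2 Y) <= norm2 g * norm2 g by rewrite ler_wpM2l.
    rewrite expr2; lra.
  have : eps * (eps * norm2 Y ^+ 2) <= eps * quad B Y by rewrite ler_pM2l.
  lra.
have h6 : tau ^+ J * (est 0 Y - obj Y) <= tau ^+ J * (dot g g / eps).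
  by rewrite ler_wpM2l// exprn_ge0.
have : dot (r J) (r J) / (2 * kappa * eps) <= tau ^+ J * (dot g g / eps).
  by rewrite -/Y in h1 h3; lra.
rewrite ler_pdivrMr ?mulr_gt0// => /le_trans; apply.
rewrite le_eqVlt; apply/orP; left; apply/eqP.
by field; rewrite gt_eqF.
Qed.

End Acceleration.
End ConjugateGradient.

(** * Capped conjugate gradients *)

(** The Gram matrix of [n + 1] such vectors would be an invertible diagonal
    matrix factoring through dimension [n]. *)
Lemma no_orthogonal_family {R : realType} {n : nat} (r : nat -> 'cV[R]_n) :
  (forall i j, (i < j <= n)%N -> dot (r j) (r i) = 0) ->
  (forall i, (i <= n)%N -> 0 < dot (r i) (r i)) -> False.
Proof.
move=> rr rpos.
pose A := \matrix_(i < n.+1, k < n) r i k 0.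
have AA : A *m A^T = diag_mx (\row_(i < n.+1) dot (r i) (r i)).
  apply/matrixP => i j; rewrite !mxE.
  have -> : \sum_k A i k * A^T k j = dot (r i) (r j).
    by apply: eq_bigr => k _; rewrite !mxE.
  have [->|ij] := eqVneq i j; first by rewrite mulr1n.
  rewrite mulr0n; have /orP[lt_ij|lt_ji] : ((i < j)%N || (j < i)%N).
  - by rewrite -neq_ltn.
  - by rewrite dotC rr// lt_ij -ltnS ltn_ord.
  - by rewrite rr// lt_ji -ltnS ltn_ord.
have : \rank (A *m A^T) = n.+1.
  apply: mxrank_unit; rewrite AA unitmxE det_diag unitfE; apply/prodf_neq0.
  by move=> i _; rewrite mxE gt_eqF// rpos// -ltnS ltn_ord.
have := mxrankM_maxl A A^T; have := rank_leq_col A.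
by move=> /[swap]/leq_trans/[apply] + e; rewrite e ltnn.
Qed.

Lemma trmx_damped {R : realType} {n : nat} (H : 'M[R]_n) (eps : R) :
  H^T = H -> (damped H eps)^T = damped H eps.
Proof. by move=> sH; rewrite /damped linearD/= tr_scalar_mx sH. Qed.

Lemma quad_damped {R : realType} {n : nat} (H : 'M[R]_n) (eps : R)
    (u : 'cV[R]_n) :
  quad (damped H eps) u = quad H u + 2 * eps * norm2 u ^+ 2.
Proof. by rewrite /quad /damped mulmxDl mul_scalar_mx dotDr dotZr norm2_sqr. Qed.

Lemma low_curv_quad {R : realType} {n : nat} (H : 'M[R]_n) (eps : R)
    (u : 'cV[R]_n) : low_curv H eps u -> quad H u < - eps * norm2 u ^+ 2.
Proof. by rewrite /low_curv quad_damped; lra. Qed.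

Section Update.
Context {R : realType} {n : nat} (H : 'M[R]_n).

Lemma updM_ge (M : R) (u : 'cV[R]_n) : 0 <= M -> M <= updM H M u.
Proof.
rewrite /updM => M0; case: ifPn => // lt_M.
have [u0|u0] := eqVneq u 0.
  by move: lt_M; rewrite u0 mulmx0 norm20 mulr0 ltxx.
by rewrite ler_pdivlMr ?norm2_gt0// ltW.
Qed.

Lemma updM_bound (M : R) (u : 'cV[R]_n) :
  norm2 (H *m u) <= updM H M u * norm2 u.
Proof.
rewrite /updM; case: ifPn => [lt_M|]; last by rewrite -leNgt.
have [u0|u0] := eqVneq u 0; first by rewrite u0 mulmx0 norm20 mulr0.
by rewrite divfK// gt_eqF// norm2_gt0.
Qed.

End Update.

Section CappedCG.
Context {R : realType} {n : nat} (H : 'M[R]_n) (g : 'cV[R]_n) (eps zeta M0 : R).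
Hypothesis symH : H^T = H.
Hypothesis g_neq0 : g != 0.
Hypothesis eps_gt0 : 0 < eps.
Hypothesis zeta01 : 0 < zeta < 1.
Hypothesis M0_ge0 : 0 <= M0.

Let st := cg_at H g eps M0.
Let y j := cg_y (st j).
Let r j := cg_r (st j).
Let p j := cg_p (st j).
Let M j := cg_M (st j).
Let B := damped H eps.
Let kappa j := cg_kappa eps (M j).

Let symB : B^T = B. Proof. exact: trmx_damped. Qed.
Let cg : conjugate_gradient B g y r p. Proof. by []. Qed.

Let M_step j : 0 <= M j -> M j <= M j.+1.
Proof.
move=> Mj; have h1 := updM_ge H _ (p j.+1) Mj.
have h2 := updM_ge H _ (y j.+1) (le_trans Mj h1).
have h3 := updM_ge H _ (r j.+1) (le_trans (le_trans Mj h1) h2).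
exact: le_trans (le_trans h1 h2) h3.
Qed.

Lemma cg_M_ge0 j : 0 <= M j.
Proof.
elim: j => [|j IH]; first exact: le_trans (updM_ge _ _ _ M0_ge0).
exact: le_trans (M_step j IH).
Qed.

Lemma cg_M_mono i j : (i <= j)%N -> M i <= M j.
Proof.
elim: j => [|j IH]; first by rewrite leqn0 => /eqP->.
rewrite leq_eqVlt => /orP[/eqP->//|/IH ij].
exact: le_trans ij (M_step j (cg_M_ge0 j)).
Qed.

(** The estimate [M] at step [j] bounds [H] on the iterates and the residuals met
    so far, which is all that the analysis uses in place of the norm of [H]. *)
Lemma cg_M_bound i j : (i <= j)%N ->
  norm2 (H *m y i) <= M j * norm2 (y i) /\ norm2 (H *m r i) <= M j * norm2 (r i).
Proof.
move=> ij; have Mij := cg_M_mono i j ij.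
suff [hy hr] : norm2 (H *m y i) <= M i * norm2 (y i) /\
    norm2 (H *m r i) <= M i * norm2 (r i).
  by split; [apply: (le_trans hy)|apply: (le_trans hr)];
     rewrite ler_wpM2r ?norm2_ge0.
case: {ij Mij} i => [|i].
  split; first by rewrite mulmx0 norm20 mulr0.
  by have := updM_bound H M0 (- g); rewrite mulmxN !norm2N.
have Mi := cg_M_ge0 i; have Mp := updM_ge H _ (p i.+1) Mi.
have My := updM_ge H _ (y i.+1) (le_trans Mi Mp).
have Mr := updM_ge H _ (r i.+1) (le_trans (le_trans Mi Mp) My).
split; last exact: updM_bound.
apply: le_trans (updM_bound H (updM H (M i) (p i.+1)) (y i.+1)) _.
by rewrite ler_wpM2r ?norm2_ge0.
Qed.

Lemma cg_kappa_ge2 j : 2 <= kappa j.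
Proof. by rewrite /kappa /cg_kappa ler_pdivlMr// lerDr cg_M_ge0. Qed.

Lemma cg_kappaM j : kappa j * eps = M j + 2 * eps.
Proof. by rewrite /kappa /cg_kappa divfK// gt_eqF. Qed.

Lemma cg_zetahat_bounds j : 0 < cg_zetahat eps zeta (M j) <= 1 / 6.
Proof.
have /andP[z0 z1] := zeta01; have k2 := cg_kappa_ge2 j.
have k0 : 0 < 3 * cg_kappa eps (M j) by rewrite -/(kappa j); lra.
rewrite /cg_zetahat divr_gt0//= ler_pdivrMr//.
by rewrite -/(kappa j); lra.
Qed.

(** Low curvature fails at [p l] and [p l] is nonzero, because its inner product
    with [r l] is minus the squared length of [r l]. *)
Lemma cg_positive N :
  (forall l, (l < N)%N -> ~~ low_curv H eps (p l)) ->
  (forall l, (l < N)%N -> 0 < dot (r l) (r l)) ->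
  forall l, (l < N)%N -> 0 < quad B (p l).
Proof.
move=> curv rpos; elim/ltn_ind => l IH lN.
have [||_ _ _ rp] := cg_orthogonality B g y r p l symB cg _ _ l (leqnn l).
- by move=> k kl; apply: IH kl (ltn_trans kl lN).
- by move=> k kl; apply: rpos (ltn_trans kl lN).
have := curv l lN; rewrite /low_curv -leNgt; apply: lt_le_trans.
rewrite mulr_gt0// exprn_gt0// norm2_gt0//; apply/eqP => p0.
by have := rpos l lN; rewrite -oppr_lt0 -rp p0 dot0r ltxx.
Qed.

Lemma cg_reach_positive j : cg_reach H g eps zeta M0 j ->
  forall l, (l < j)%N -> ~~ low_curv H eps (p l) /\ 0 < dot (r l) (r l).
Proof.
move=> [_ p0 tests] [|l] lj.
  by split=> //; rewrite -norm2_sqr exprn_gt0// norm2_gt0.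
have /and4P[_ t2 t3 _] := tests l.+1 lj.
split=> //; rewrite -norm2_sqr exprn_gt0//.
move: t2; rewrite /cg_test2 -ltNge; apply: le_lt_trans.
by rewrite mulr_ge0 ?norm2_ge0//; have /andP[/ltW] := cg_zetahat_bounds l.+1.
Qed.

(** The accuracy test bounds the residual by a multiple of [|g|]; as
    [|g| <= |r j| + kappa eps |y j|], it is in fact small with respect to
    [|y j|]. *)
Lemma cg_solution j : cg_reach H g eps zeta M0 j ->
    ~~ cg_test1 H g eps M0 j -> cg_test2 H g eps zeta M0 j ->
  [/\ y j != 0, eps * norm2 (y j) ^+ 2 <= quad B (y j),
      dot (y j) g = - quad B (y j)
    & norm2 (B *m y j + g) <= eps * zeta / 2 * norm2 (y j)].
Proof.
move=> rj t1 t2; have pos := cg_reach_positive j rj.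
have res := cg_residual B g y r p cg j.
have /andP[z0 z6] := cg_zetahat_bounds j; have k2 := cg_kappa_ge2 j.
have ng : 0 < norm2 g by rewrite norm2_gt0.
move: t2; rewrite /cg_test2 -/(st j) -/(r j) -/(M j) => t2.
have Bz u : norm2 (H *m u) <= M j * norm2 u ->
    norm2 (B *m u) <= kappa j * eps * norm2 u.
  move=> Hu; rewrite /B /damped mulmxDl mul_scalar_mx.
  apply: le_trans (norm2D _ _) _; rewrite norm2Z ger0_norm ?mulr_ge0 ?(ltW eps_gt0)//.
  by rewrite cg_kappaM; lra.
have nB := Bz _ (cg_M_bound j j (leqnn _)).1.
have ngle : norm2 g <= norm2 (r j) + norm2 (B *m y j).
  by have := norm2B (r j) (B *m y j); rewrite res addrAC subrr add0r.
have y0 : y j != 0.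
  apply/eqP => yj; move: ngle t2; rewrite yj mulmx0 norm20 addr0.
  have : cg_zetahat eps zeta (M j) * norm2 g <= 1 / 6 * norm2 g by rewrite ler_pM2r.
  lra.
split=> //.
- by move: t1; rewrite /cg_test1 /low_curv -leNgt.
- have : dot (r j) (y j) = 0.
    apply: (cg_residual_perp_iterate B g y r p j symB cg _ _ j j); last by rewrite leqnn.
      by apply: cg_positive => l lj; have [] := pos l lj.
    by move=> l lj; have [] := pos l lj.
  by rewrite res dotDl dotC /quad -/B (dotC g); lra.
rewrite -res.
have zk : cg_zetahat eps zeta (M j) * (kappa j * eps) = zeta * eps / 3.
  by rewrite /cg_zetahat -/(kappa j); field; rewrite gt_eqF//; lra.
set zh := cg_zetahat _ _ _ in z0 z6 t2 zk.
have h1 : zh * norm2 g <= zh * norm2 (r j) + zh * (kappa j * eps * norm2 (y j)).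
  rewrite -mulrDr ler_pM2l//; lra.
have h2 : zh * (kappa j * eps * norm2 (y j)) = zeta * eps / 3 * norm2 (y j).
  by rewrite mulrA zk.
have h3 : zh * norm2 (r j) <= 1 / 6 * norm2 (r j) by rewrite ler_wpM2r ?norm2_ge0.
have h4 : 0 <= zeta * eps * norm2 (y j).
  by rewrite !mulr_ge0 ?norm2_ge0// ltW//; case/andP: zeta01.
lra.
Qed.

Lemma cg_tau_bounds j (tau := cg_tau eps (M j)) :
  [/\ 0 < tau, tau < 1 & (1 - tau) ^+ 2 * kappa j <= 1].
Proof.
rewrite /tau /cg_tau -/(kappa j); have k2 := cg_kappa_ge2 j.
have s0 : 0 < Num.sqrt (kappa j) by rewrite sqrtr_gt0; lra.
have sk : Num.sqrt (kappa j) ^+ 2 = kappa j by rewrite sqr_sqrtr//; lra.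
set s := Num.sqrt _ in s0 sk *; rewrite -sk.
have s1 : 0 < s + 1 by lra.
split; [by rewrite divr_gt0|by rewrite ltr_pdivrMr// mul1r; lra|].
have -> : (1 - s / (s + 1)) ^+ 2 * s ^+ 2 = (s / (s + 1)) ^+ 2.
  by field; rewrite gt_eqF.
by rewrite expr_le1 ?divr_ge0 ?(ltW s0) ?(ltW s1)// ler_pdivrMr// mul1r; lra.
Qed.

(** The factor [T] in the test is much larger than the [2 kappa] that
    [cg_linear_rate] calls for. *)
Lemma cg_test4_lower_bound j : cg_test4 H g eps M0 j ->
  2 * kappa j * cg_tau eps (M j) ^+ j * dot g g < dot (r j) (r j).
Proof.
have [t0 t1 _] := cg_tau_bounds j; have k2 := cg_kappa_ge2 j.
rewrite /cg_test4 -/(st j) -/(M j) -/(r j); set tau := cg_tau _ _ in t0 t1 *.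
rewrite -(@ltr_pXn2r _ 2%N) ?nnegrE ?norm2_ge0 ?mulr_ge0 ?norm2_ge0 ?sqrtr_ge0
  ?powR_ge0//.
rewrite 2!exprMn !norm2_sqr -(powR_mulrn 2 (powR_ge0 _ _)) -powRrM.
rewrite divfK// (powR_mulrn _ (ltW t0)); apply: le_lt_trans.
rewrite ler_wpM2r ?dot_ge0// ler_wpM2r ?exprn_ge0 ?(ltW t0)//.
have st0 : 0 < Num.sqrt tau by rewrite sqrtr_gt0.
have st1 : Num.sqrt tau < 1 by rewrite -[ltRHS]sqrtr1 ltr_sqrt.
have d0 : 0 < (1 - Num.sqrt tau) ^+ 2 by rewrite exprn_gt0//; lra.
have d1 : (1 - Num.sqrt tau) ^+ 2 <= 1 by rewrite expr_le1//; lra.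
have T_ge : 2 * kappa j <= cg_T eps (M j).
  rewrite /cg_T -/tau -/(kappa j) ler_pdivlMr//.
  have k3 : 1 <= kappa j ^+ 3 by rewrite exprn_ege1//; lra.
  have : 2 * kappa j * (1 - Num.sqrt tau) ^+ 2 <= 2 * kappa j * 1.
    by rewrite ler_wpM2l//; lra.
  have : kappa j * 1 <= kappa j * kappa j ^+ 3 by rewrite ler_wpM2l//; lra.
  rewrite [kappa j ^+ 4]exprS; lra.
by rewrite sqr_sqrtr//; lra.
Qed.

Lemma cg_slow_convergence j : cg_reach H g eps zeta M0 j ->
    ~~ cg_test2 H g eps zeta M0 j -> ~~ cg_test3 H g eps M0 j ->
    cg_test4 H g eps M0 j ->
  exists2 i, (i < j)%N & low_curv H eps (y j.+1 - y i).
Proof.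
move=> rj t2 t3 t4; apply: contrapT => no_i.
have pos l : (l < j.+1)%N -> ~~ low_curv H eps (p l) /\ 0 < dot (r l) (r l).
  rewrite ltnS leq_eqVlt => /orP[/eqP->|]; last exact: cg_reach_positive.
  split=> //; rewrite -norm2_sqr exprn_gt0//.
  move: t2; rewrite /cg_test2 -ltNge; apply: le_lt_trans.
  by rewrite mulr_ge0 ?norm2_ge0//; have /andP[/ltW] := cg_zetahat_bounds j.
have j0 : (0 < j)%N by case: rj.
have k2 := cg_kappa_ge2 j; have [t0 t1 tk] := cg_tau_bounds j.
have := cg_test4_lower_bound j t4; rewrite ltNge => /negP; apply.
apply: (cg_linear_rate B g y r p j.+1 symB cg _ _ eps) => //.
- by apply: cg_positive => l lj; have [] := pos l lj.
- by move=> l lj; have [] := pos l lj.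
- by lra.
- by rewrite !ltW.
- move=> l lj; rewrite /B quad_damped norm2_sqr cg_kappaM.
  suff : quad H (r l) <= M j * dot (r l) (r l) by lra.
  apply: le_trans (dot_le_norm2 _ _) _.
  rewrite -norm2_sqr expr2 mulrA [leRHS]mulrC ler_wpM2l ?norm2_ge0//.
  exact: (cg_M_bound l j lj).2.
- by move=> i ij; rewrite leNgt; apply/negP => lc; apply: no_i; exists i.
Qed.

(** The residuals of the steps reached are nonzero and orthogonal, so that only
    finitely many steps are reached. *)
Lemma capped_cg_returns : exists d t, capped_cg H g eps zeta M0 d t.
Proof.
apply: contrapT => none.
have no d t : ~ capped_cg H g eps zeta M0 d t by move=> h; apply: none; exists d, t.
have p0 : ~~ low_curv H eps (- g) by apply/negP => h; apply: (no _ _ (CG_p0 _ _ h)).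
have reach j : cg_reach H g eps zeta M0 j.+1.
  elim: j => [|j IH]; first by split=> // -[|l]; rewrite ?ltnn ?andbF.
  split=> // l /andP[l0]; rewrite ltnS leq_eqVlt => /orP[/eqP->|lj]; last first.
    by have [_ _ h] := IH; apply: h; rewrite l0.
  have t1 : ~~ cg_test1 H g eps M0 j.+1.
    by apply/negP => t1; apply: (no _ _ (CG_y IH t1)).
  have t2 : ~~ cg_test2 H g eps zeta M0 j.+1.
    by apply/negP => t2; apply: (no _ _ (CG_sol IH t1 t2)).
  have t3 : ~~ cg_test3 H g eps M0 j.+1.
    by apply/negP => t3; apply: (no _ _ (CG_p IH t1 t2 t3)).
  rewrite t1 t2 t3 /=; apply/negP => t4.
  have [i ij lc] := cg_slow_convergence _ IH t2 t3 t4.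
  exact: (no _ _ (CG_slow IH t1 t2 t3 t4 ij lc)).
have pos l : ~~ low_curv H eps (p l) /\ 0 < dot (r l) (r l).
  exact: cg_reach_positive (reach l) l (ltnSn l).
apply: (no_orthogonal_family r) => [i j /andP[ij jn]|i _]; last exact: (pos i).2.
have [||rr _ _ _] := cg_orthogonality B g y r p j symB cg _ _ j (leqnn j);
  last exact: rr.
  by apply: cg_positive => l _; have [] := pos l.
by move=> l _; exact: (pos l).2.
Qed.

Lemma capped_cg_nc d : capped_cg H g eps zeta M0 d NC -> low_curv H eps d.
Proof.
move: {-2}NC (erefl NC) => t et h; case: h et => //.
Qed.

Lemma capped_cg_sol d : capped_cg H g eps zeta M0 d SOL ->
  [/\ d != 0, eps * norm2 d ^+ 2 <= quad B d, dot d g = - quad B d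
    & norm2 (B *m d + g) <= eps * zeta / 2 * norm2 d].
Proof.
move: {-2}SOL (erefl SOL) => t et h; case: h et => //.
by move=> j rj t1 t2 _; exact: cg_solution.
Qed.

End CappedCG.

(** * Second-order calculus along segments *)

Lemma MVT01 {R : realType} (phi dphi : R -> R) (a : R) : 0 < a ->
  (forall t, 0 <= t <= a -> is_derive t 1 phi (dphi t)) ->
  exists2 c, 0 <= c <= a & phi a - phi 0 = a * dphi c.
Proof.
move=> a0 D.
have [t||c] := @MVT R phi dphi 0 a a0.
- by rewrite in_itv/= => /andP[/ltW t0 /ltW t1]; apply: D; rewrite t0.
- apply: derivable_within_continuous => t; rewrite in_itv/= => t01.
  exact: (@ex_derive _ _ _ _ _ _ _ (D t t01)).
rewrite in_itv/= subr0 => /andP[/ltW c0 /ltW c1] ->.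
by exists c; [rewrite c0|rewrite mulrC].
Qed.

(** The difference quotients on both sides are the same function. *)
Lemma is_derive_line {R : realType} {V W : normedModType R} (f : V -> W)
    (x d : V) (t : R) : derivable f (x + t *: d) d ->
  is_derive t 1 (fun s : R => f (x + s *: d)) ('D_d f (x + t *: d)).
Proof.
move=> df.
have e : (fun h : R => h^-1 *: (f (x + (h *: 1 + t) *: d) - f (x + t *: d))) =
         (fun h : R => h^-1 *: (f (h *: d + (x + t *: d)) - f (x + t *: d))).
  by apply/funext => h; rewrite [h *: 1]mulr1 scalerDl addrCA.
by apply: DeriveDef; [rewrite /derivable e|rewrite /derive e].
Qed.

Lemma derive_coordinates {R : realType} {n : nat} (F : 'cV[R]_n -> R)
    (x d : 'cV[R]_n) : differentiable F x ->
  'D_d F x = \sum_(i < n) d i 0 * 'D_(delta_mx i 0 : 'cV[R]_n) F x.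
Proof.
move=> dF; rewrite deriveE//.
have -> : d = \sum_(i < n) d i 0 *: (delta_mx i 0 : 'cV[R]_n).
  by rewrite {1}[d]matrix_sum_delta; apply: eq_bigr => i _; rewrite big_ord1.
rewrite linear_sum; apply: eq_bigr => i _.
rewrite linearZ deriveE//; congr (_ *: _).
rewrite summxE (bigD1 i)//= big1 => [|k ki]; rewrite !mxE ?eqxx ?mulr1 ?addr0//.
by rewrite eq_sym (negbTE ki) mulr0.
Qed.

Section SecondOrder.
Context {R : realType} {n : nat} (f : 'cV[R]_n -> R) (U : set 'cV[R]_n) (L : R).
Hypothesis fU : lipschitz_C2_on U L f.
Implicit Types x d w : 'cV[R]_n.

Lemma is_derive_f_line x d (t : R) : U (x + t *: d) ->
  is_derive t 1 (fun s : R => f (x + s *: d)) (dot (grad f (x + t *: d)) d).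
Proof.
case: fU => df _ _ Ut; have dft := df _ Ut.
rewrite (_ : dot _ _ = 'D_d f (x + t *: d)).
  by apply: is_derive_line; exact: diff_derivable.
rewrite derive_coordinates//; apply: eq_bigr => i _.
by rewrite /grad mxE mulrC.
Qed.

Lemma is_derive_grad_line x d w (t : R) : U (x + t *: d) ->
  is_derive t 1 (fun s : R => dot w (grad f (x + s *: d)))
    (dot w (hess f (x + t *: d) *m d)).
Proof.
case: fU => _ dg _ Ut; have dgt := dg _ Ut.
pose F i z := grad f z i 0.
have dF i : differentiable (F i) (x + t *: d).
  exact: (differentiable_comp dgt (differentiable_coord _ _ _)).
have -> : (fun s : R => dot w (grad f (x + s *: d))) =
    \sum_(i < n) (fun s : R => w i 0 *: F i (x + s *: d)).
  by apply/funext => s; rewrite fct_sumE.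
apply: is_derive_sum => i.
rewrite (_ : (hess f (x + t *: d) *m d) i 0 = 'D_d (F i) (x + t *: d)).
  by apply: is_deriveZ; apply: is_derive_line; exact: diff_derivable.
rewrite derive_coordinates// mxE; apply: eq_bigr => j _.
by rewrite /hess mxE mulrC.
Qed.


End SecondOrder.

(** The Taylor bounds depend on the gradient and the Hessian only through these
    properties. Keeping both abstract prevents comparisons of their values at
    two points from unfolding the limits that define them. *)
Record second_order_model {R : realType} {n : nat} (U : set 'cV[R]_n) (L : R)
    (f : 'cV[R]_n -> R) (G : 'cV[R]_n -> 'cV[R]_n) (Hs : 'cV[R]_n -> 'M[R]_n) :
    Prop := {
  model_grad : forall (x d : 'cV[R]_n) (t : R), U (x + t *: d) ->
    is_derive t 1 (fun s : R => f (x + s *: d)) (dot (G (x + t *: d)) d);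
  model_hess : forall (x d w : 'cV[R]_n) (t : R), U (x + t *: d) ->
    is_derive t 1 (fun s : R => dot w (G (x + s *: d)))
      (dot w (Hs (x + t *: d) *m d));
  model_lipschitz : forall x z u : 'cV[R]_n, U x -> U z ->
    norm2 ((Hs z - Hs x) *m u) <= L * norm2 (z - x) * norm2 u }.

Lemma lipschitz_C2_model {R : realType} {n : nat} (U : set 'cV[R]_n) (L : R)
    (f : 'cV[R]_n -> R) :
  lipschitz_C2_on U L f -> second_order_model U L f (grad f) (hess f).
Proof.
move=> fU; split.
- exact: is_derive_f_line fU.
- exact: is_derive_grad_line fU.
case: fU => _ _ hL x z u Ux Uz; apply: le_trans (norm2_mulmx_le _ _) _.
by rewrite ler_wpM2r ?norm2_ge0//; exact: hL.
Qed.

Section Taylor.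
Context {R : realType} {n : nat} (U : set 'cV[R]_n) (L : R)
  (f : 'cV[R]_n -> R) (G : 'cV[R]_n -> 'cV[R]_n) (Hs : 'cV[R]_n -> 'M[R]_n).
Hypothesis fU : second_order_model U L f G Hs.
Implicit Types x z u v d w : 'cV[R]_n.

Lemma dot_hess_lipschitz x z u w : U x -> U z ->
  dot w (Hs z *m u) - dot w (Hs x *m u)
    <= L * norm2 (z - x) * norm2 w * norm2 u.
Proof.
move=> Ux Uz; rewrite -dotBr -mulmxBl.
apply: le_trans (dot_le_norm2 _ _) _; rewrite mulrAC mulrC.
by rewrite ler_wpM2r ?norm2_ge0//; exact: (model_lipschitz _ _ _ _ _ fU).
Qed.

Section Segment.
Context (x d : 'cV[R]_n) (line : R -> 'cV[R]_n).
Hypothesis lineE : line = (fun t => x + t *: d).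
Hypothesis seg : forall t : R, 0 <= t <= 1 -> U (line t).

Let line0 : line 0 = x. Proof. by rewrite lineE scale0r addr0. Qed.
Let line1 : line 1 = x + d. Proof. by rewrite lineE scale1r. Qed.

Let Ux : U x.
Proof. by rewrite -line0; apply: seg; rewrite lexx ler01. Qed.

(** The derivative of the left side minus the right side along the segment is
    at most [0] by the Lipschitz bound. *)
Lemma dot_grad_taylor w (t : R) : 0 <= t <= 1 ->
  dot w (G (line t)) <= dot w (G x) + t * dot w (Hs x *m d)
    + t ^+ 2 * (L / 2 * norm2 d ^+ 2 * norm2 w).
Proof.
move=> /andP[]; rewrite le_eqVlt => /orP[/eqP<- _|t0 t1].
  by rewrite line0 expr0n/= !mul0r !addr0.
set C := L / 2 * norm2 d ^+ 2 * norm2 w.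
pose q s : R := dot w (G (line s)) - (s * dot w (Hs x *m d) + s ^+ 2 * C).
have [|c /andP[c0 ct] e] := @MVT01 _ q (fun s =>
  dot w (Hs (line s) *m d) - (dot w (Hs x *m d) + 2 * s * C)) t t0.
  move=> s /andP[s0 st].
  have D1 : is_derive s 1 (fun s : R => dot w (G (line s)))
      (dot w (Hs (line s) *m d)).
    have := seg s; rewrite s0 (le_trans st t1) => /(_ isT).
    by rewrite lineE; exact: (model_hess _ _ _ _ _ fU).
  have D2 : is_derive s 1 (fun s : R => s * dot w (Hs x *m d) + s ^+ 2 * C)
      (dot w (Hs x *m d) + 2 * s * C).
    by apply: is_derive_eq; rewrite /GRing.scale/=; ring.
  exact: is_deriveB.
have h : dot w (Hs (line c) *m d) - (dot w (Hs x *m d) + 2 * c * C) <= 0.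
  have Uc : U (line c) by apply: seg; rewrite c0 (le_trans ct).
  have := dot_hess_lipschitz x (line c) d w Ux Uc.
  have -> : norm2 (line c - x) = c * norm2 d.
    by rewrite lineE addrAC subrr add0r norm2Z ger0_norm.
  rewrite /C; lra.
move: h; rewrite -(pmulr_rle0 _ t0) -e /q line0; lra.
Qed.

Lemma grad_taylor : 0 <= L ->
  norm2 (G (x + d) - G x - Hs x *m d) <= L / 2 * norm2 d ^+ 2.
Proof.
move=> L0; set w := _ - _ - _.
have [w0|w0] := eqVneq w 0.
  by rewrite w0 norm20 mulr_ge0 ?sqr_ge0// divr_ge0.
have /dot_grad_taylor : 0 <= (1 : R) <= 1 by rewrite ler01 lexx.
move=> /(_ w); rewrite line1 !(mul1r, expr1n) => h.
rewrite -(ler_pM2r (norm2_gt0 _ w0)); move: h.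
have : norm2 w ^+ 2 = dot w (G (x + d)) - dot w (G x)
    - dot w (Hs x *m d) by rewrite norm2_sqr -!dotBr.
rewrite -expr2; lra.
Qed.

Lemma taylor :
  f (x + d) <= f x + dot (G x) d + quad (Hs x) d / 2
    + L / 6 * norm2 d ^+ 3.
Proof.
set a := dot (G x) d; set b := quad (Hs x) d.
set C := norm2 d ^+ 3.
pose q s : R := f (line s) - (s * a + s ^+ 2 * (b / 2) + s ^+ 3 * (L / 6 * C)).
have [|c c01 e] := @MVT01 _ q (fun s => dot (G (line s)) d
  - (a + s * b + s ^+ 2 * (L / 2 * C))) 1 ltr01.
  move=> s s01.
  have D1 : is_derive s 1 (fun s : R => f (line s)) (dot (G (line s)) d).
    by have := seg s s01; rewrite lineE; exact: (model_grad _ _ _ _ _ fU).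
  have D2 : is_derive s 1
      (fun s : R => s * a + s ^+ 2 * (b / 2) + s ^+ 3 * (L / 6 * C))
      (a + s * b + s ^+ 2 * (L / 2 * C)).
    by apply: is_derive_eq; rewrite /GRing.scale/=; lra.
  exact: is_deriveB.
have := dot_grad_taylor d c c01.
rewrite [dot d (G x)]dotC [dot d (G _)]dotC -/a -/(quad _ d) -/b.
move: e; rewrite /q line0 line1 -[in L / 2 * _ * _](mulrA _ _ (norm2 d)) -exprSr -/C.
lra.
Qed.

End Segment.

(** The mean value theorem, applied in the direction [u] and then in [v]. *)
Lemma mixed_difference x u v (a : R) : 0 < a ->
    (forall s t : R, 0 <= s <= a -> 0 <= t <= a -> U (x + s *: u + t *: v)) ->
  exists z, [/\ U z, norm2 (z - x) <= a * (norm2 u + norm2 v) &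
    f (x + a *: u + a *: v) - f (x + a *: u) - f (x + a *: v) + f x
      = a ^+ 2 * dot u (Hs z *m v)].
Proof.
move=> a0 inU; have aa : 0 <= a <= a by rewrite lexx ltW.
have oa : 0 <= (0 : R) <= a by rewrite lexx ltW.
have [|s s0a es] := @MVT01 _
    (fun s => f (x + a *: v + s *: u) - f (x + s *: u))
    (fun s => dot (G (x + a *: v + s *: u)) u - dot (G (x + s *: u)) u)
    a a0.
  move=> s s0a; apply: is_deriveB; apply: (model_grad _ _ _ _ _ fU).
    by rewrite addrAC; exact: inU.
  by have := inU s 0 s0a oa; rewrite scale0r addr0.
have [|t t0a et] := @MVT01 _
    (fun t => dot u (G (x + s *: u + t *: v)))
    (fun t => dot u (Hs (x + s *: u + t *: v) *m v)) a a0.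
  by move=> t t0a; apply: (model_hess _ _ _ _ _ fU); exact: inU.
exists (x + s *: u + t *: v); split; first exact: inU.
  have -> : x + s *: u + t *: v - x = s *: u + t *: v.
    by rewrite -[x + _ + _]addrA [x + _]addrC addrK.
  move: s0a t0a => /andP[s0 sa] /andP[t0 ta]; apply: le_trans (norm2D _ _) _.
  by rewrite !norm2Z !ger0_norm// mulrDr lerD// ler_wpM2r ?norm2_ge0.
move: es et; rewrite !scale0r !addr0 ![dot (G _) u]dotC.
rewrite ![x + a *: v + _]addrAC => es et.
rewrite expr2 -mulrA -et -es; ring.
Qed.

(** Schwarz's theorem: the mixed difference is symmetric in [u] and [v], and by
    continuity of the Hessian its two expressions tend to the two sides. *)
Lemma trmx_hess x : open U -> U x -> 0 <= L -> (Hs x)^T = Hs x.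
Proof.
move=> oU Ux L0.
suff le_sym (u v : 'cV[R]_n) : dot u (Hs x *m v) <= dot v (Hs x *m u).
  apply/matrixP => i j; rewrite mxE.
  have E k l : dot (delta_mx k 0 : 'cV[R]_n) (Hs x *m delta_mx l 0)
      = Hs x k l.
    rewrite /dot (bigD1 k)//= big1 => [|m mk].
      by rewrite -colE !mxE !eqxx mul1r addr0.
    by rewrite mxE (negbTE mk) mul0r.
  by apply/eqP; rewrite eq_le -!E !le_sym.
rewrite -subr_le0; set D := _ - _; rewrite leNgt; apply/negP => D0.
have /nbhs_ballP[e /= e0 eU] : nbhs x U by apply: open_nbhs_nbhs.
pose S := `|u| + `|v| + 1.
pose C := 2 * (L * (norm2 u + norm2 v) * norm2 u * norm2 v) + 1.
have S0 : 0 < S by rewrite ltr_wpDl// addr_ge0.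
have C0 : 0 < C by rewrite ltr_wpDl// !mulr_ge0 ?addr_ge0 ?norm2_ge0.
pose a := Num.min (e / S / 2) (D / C / 2).
have a0 : 0 < a by rewrite lt_min !divr_gt0.
have ae : a * S < e.
  rewrite -ltr_pdivlMr// gt_min; apply/orP; left.
  have : 0 < e / S by rewrite divr_gt0.
  lra.
have aD : a * C < D.
  rewrite -ltr_pdivlMr// gt_min; apply/orP; right.
  have : 0 < D / C by rewrite divr_gt0.
  lra.
have inU s t : 0 <= s <= a -> 0 <= t <= a -> U (x + s *: u + t *: v).
  move=> /andP[s0 sa] /andP[t0 ta]; apply: eU.
  rewrite -ball_normE /ball_/= -addrA opprD addrA subrr sub0r normrN.
  apply: le_lt_trans (ler_normD _ _) _; rewrite !normrZ !ger0_norm//.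
  apply: le_lt_trans ae; rewrite /S !mulrDr.
  have h1 : s * `|u| <= a * `|u| by rewrite ler_wpM2r.
  have h2 : t * `|v| <= a * `|v| by rewrite ler_wpM2r.
  lra.
have inU' s t : 0 <= s <= a -> 0 <= t <= a -> U (x + s *: v + t *: u).
  by move=> s0 t0; rewrite addrAC; exact: inU.
have [z [Uz zx e1]] := mixed_difference x u v a a0 inU.
have [z' [Uz' zx' e2]] := mixed_difference x v u a a0 inU'.
have {e1 e2}eD : dot u (Hs z *m v) = dot v (Hs z' *m u).
  apply/eqP; rewrite -(inj_eq (mulfI (lt0r_neq0 (exprn_gt0 2 a0)))) -e1 -e2.
  by rewrite [x + a *: v + _]addrAC; apply/eqP; ring.
have Lz : L * norm2 (z - x) * norm2 u * norm2 v
    <= L * (a * (norm2 u + norm2 v)) * norm2 u * norm2 v.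
  by rewrite !ler_wpM2r ?norm2_ge0// ler_wpM2l.
have Lz' : L * norm2 (z' - x) * norm2 v * norm2 u
    <= L * (a * (norm2 v + norm2 u)) * norm2 v * norm2 u.
  by rewrite !ler_wpM2r ?norm2_ge0// ler_wpM2l.
have h1 := dot_hess_lipschitz x z v (- u) Ux Uz.
have h2 := dot_hess_lipschitz x z' u v Ux Uz'.
move: h1; rewrite !dotNl norm2N => h1.
have h3 : D <= a * (C - 1) by rewrite /D /C; lra.
lra.
Qed.

(** Consider the largest [m] such that the segment up to [m] stays in the level
    set. As [U] is open, the segment stays in [U] a little beyond [m], and there
    [desc] keeps it in the level set. *)
Lemma descent_segment (l : R) x d :
    open U -> [set z | f z <= l] `<=` U -> closed [set z | f z <= l] ->
    f x <= l ->
    (forall t : R, 0 <= t <= 1 ->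
       (forall s : R, 0 <= s <= t -> U (x + s *: d)) -> f (x + t *: d) <= l) ->
  forall t : R, 0 <= t <= 1 -> f (x + t *: d) <= l.
Proof.
move=> oU lU cl fx desc.
pose S := [set t : R | 0 <= t <= 1 /\ forall s, 0 <= s <= t -> f (x + s *: d) <= l].
have S0 : S 0.
  split=> [|s s0]; first by rewrite lexx ler01.
  by rewrite -(le_anti s0) scale0r addr0.
have supS : has_sup S by split; [exists 0|exists 1 => t [/andP[]]].
set m := sup S.
have m0 : 0 <= m by apply: ub_le_sup => //; case: supS.
have m1 : m <= 1 by apply: ge_sup => [|t [/andP[]]//]; exists 0.
have below s : 0 <= s < m -> f (x + s *: d) <= l.
  move=> /andP[s0 /(sup_gt (ex_intro _ 0 S0))[t [_ h] st]].
  by apply: h; rewrite s0 ltW.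
have contL t : continuous_at t (fun s : R => x + s *: d).
  by apply: cvgD; [exact: cvg_cst|apply: scalel_continuous].
have Um : U (x + m *: d).
  apply: lU; apply: contrapT => nm.
  have : nbhs m ((fun s : R => x + s *: d) @^-1` ~` [set z | f z <= l]).
    apply: contL; apply: open_nbhs_nbhs; split=> //; exact: closed_openC.
  move=> /nbhs_ballP[e /= e0 he].
  have [mz|mz] := eqVneq m 0; first by apply: nm; rewrite mz scale0r addr0.
  have mp : 0 < m by rewrite lt_def mz.
  (* Points just below [m] are in the level set and within [e] of [m]. *)
  pose s := Num.max 0 (m - e / 2).
  have sm : s < m by rewrite gt_max mp; lra.
  have : ball m e s.
    rewrite /ball/= ger0_norm ?subr_ge0 ?ltW// ltrBlDr -ltrBlDl.
    by rewrite lt_max; apply/orP; right; lra.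
  by move=> /he; apply; apply: below; rewrite sm le_max lexx.
have : nbhs m ((fun s : R => x + s *: d) @^-1` U).
  by apply: contL; exact: open_nbhs_nbhs.
move=> /nbhs_ballP[e /= e0 he].
have Sm (t : R) : 0 <= t <= 1 -> t < m + e -> f (x + t *: d) <= l.
  move=> /andP[t0 t1] te; apply: desc; first by rewrite t0.
  move=> s /andP[s0 st]; have [sm|ms] := ltP s m; first by apply/lU/below; rewrite s0.
  by apply: he; rewrite /ball/= distrC ger0_norm ?subr_ge0//; lra.
have m_eq1 : m = 1.
  apply/eqP; rewrite eq_le m1/= leNgt; apply/negP => m_lt1.
  pose t := Num.min 1 (m + e / 2).
  have mt : m < t by rewrite lt_min m_lt1; lra.
  have tme : t < m + e by rewrite gt_min; apply/orP; right; lra.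
  have t1 : t <= 1 by rewrite ge_min lexx.
  have : S t.
    split=> [|s /andP[s0 st]]; first by rewrite t1 (le_trans m0)// ltW.
    by apply: Sm; [rewrite s0 (le_trans st)|exact: le_lt_trans st tme].
  move=> St; have : t <= m by apply: ub_le_sup => //; case: supS.
  by rewrite leNgt mt.
move=> t t01; apply: Sm => //; rewrite m_eq1; case/andP: t01 => _ t1.
by rewrite (le_lt_trans t1)// ltrDl.
Qed.

End Taylor.

(** * Line search *)

Lemma expr_small {R : realType} (theta a : R) : 0 < theta < 1 -> 0 < a ->
  exists j : nat, theta ^+ j <= a.
Proof.
move=> /andP[t0 t1] a0.
have /cvg_expr /(_ _ (nbhsx_ballx _ _ a0))[N _ /(_ N (leqnn N))] : `|theta| < 1.
  by rewrite ger0_norm// ltW.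
rewrite /ball/= sub0r normrN => /ltW h; exists N.
by apply: le_trans h; exact: ler_norm.
Qed.

Lemma line_search_succeeds {R : realType} {n : nat} (f : 'cV[R]_n -> R)
    (theta eta : R) (x d : 'cV[R]_n) (a : R) : 0 < theta < 1 -> 0 < a ->
  (forall b : R, 0 < b <= a -> decrease f eta x d b) ->
  exists j, line_search f theta eta x d j.
Proof.
move=> t01 a0 dec; have [j ja] := expr_small theta a t01 a0.
have ex : exists j, decrease f eta x d (theta ^+ j).
  by exists j; apply: dec; rewrite ja exprn_gt0//; case/andP: t01.
exists (ex_minn ex); case: ex_minnP => k dk kmin; split=> // i ik.
by apply/negP => /kmin; rewrite leqNgt ik.
Qed.

(** The reason for backtracking: the trial step before the accepted one was
    rejected. *)
Lemma line_search_prev {R : realType} {n : nat} (f : 'cV[R]_n -> R)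
    (theta eta : R) (x d : 'cV[R]_n) (j : nat) : 0 < theta < 1 ->
  line_search f theta eta x d j ->
  j = 0%N \/ exists2 b : R, ~~ decrease f eta x d b &
    0 < b <= 1 /\ theta ^+ j = theta * b.
Proof.
move=> /andP[t0 t1]; case: j => [|j] [_ ls]; [by left|right].
exists (theta ^+ j); first exact: ls.
by rewrite exprS exprn_gt0// exprn_ile1// ltW.
Qed.

(** * Damped Newton steps *)

Section Steps.
Context {R : realType} {n : nat} (U : set 'cV[R]_n) (L : R)
  (f : 'cV[R]_n -> R) (G : 'cV[R]_n -> 'cV[R]_n) (Hs : 'cV[R]_n -> 'M[R]_n)
  (l eps eta theta zeta : R) (x : 'cV[R]_n).
Hypothesis fU : second_order_model U L f G Hs.
Hypothesis oU : open U.
Hypothesis lU : [set z | f z <= l] `<=` U.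
Hypothesis cl : closed [set z | f z <= l].
Hypothesis fx : f x <= l.
Hypothesis L0 : 0 <= L.
Hypothesis eps0 : 0 < eps.
Hypothesis eta0 : 0 < eta.
Hypothesis theta01 : 0 < theta < 1.
Hypothesis zeta01 : 0 < zeta < 1.

Let t0 : 0 < theta. Proof. by case/andP: theta01. Qed.
Let t1 : theta < 1. Proof. by case/andP: theta01. Qed.
Let z0 : 0 < zeta. Proof. by case/andP: zeta01. Qed.
Let z1 : zeta < 1. Proof. by case/andP: zeta01. Qed.
Let Le0 : 0 < L + eta. Proof. exact: ltr_wpDl. Qed.

(** The Taylor bound is available only on segments in [U]; its right side being
    at most [f x] keeps the segment in the level set, hence in [U]. *)
Lemma model_descent (d : 'cV[R]_n) :
  (forall t : R, 0 <= t <= 1 -> t * dot (G x) d + t ^+ 2 * quad (Hs x) d / 2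
     + L / 6 * (t * norm2 d) ^+ 3 <= 0) ->
  forall t : R, 0 <= t <= 1 -> U (x + t *: d).
Proof.
move=> desc t t01; apply: lU => /=.
apply: (descent_segment U f l x d oU lU cl fx _ t t01) => {}t {}t01 seg.
apply: le_trans (taylor _ _ _ _ _ fU x (t *: d) _ erefl _) _.
  move=> s /andP[s0 s1]; rewrite scalerA; apply: seg.
  by case/andP: t01 => t_ge0 _; rewrite mulr_ge0// ler_piMl.
case/andP: (t01) => t_ge0 _; have := desc t t01.
rewrite dotZr /quad -scalemxAr dotZr dotZl norm2Z (ger0_norm t_ge0).
move: fx; lra.
Qed.

Lemma decrease_of_model (d : 'cV[R]_n) (a : R) : 0 <= a ->
  (forall t : R, 0 <= t <= 1 -> U (x + t *: (a *: d))) ->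
  a * dot (G x) d + a ^+ 2 * quad (Hs x) d / 2
    + (L + eta) / 6 * (a * norm2 d) ^+ 3 < 0 ->
  decrease f eta x d a.
Proof.
move=> a_ge0 seg neg; rewrite /decrease.
apply: le_lt_trans (taylor _ _ _ _ _ fU x (a *: d) _ erefl seg) _.
move: neg; rewrite dotZr /quad -scalemxAr dotZr dotZl norm2Z (ger0_norm a_ge0).
rewrite expr2 exprMn -!mulrA; lra.
Qed.

Section NegativeCurvature.
Context (d : 'cV[R]_n).
Hypothesis d_long : eps <= norm2 d.
Hypothesis d_slope : dot (G x) d <= 0.
Hypothesis d_curv : quad (Hs x) d <= - norm2 d ^+ 3.

Let N0 : 0 < norm2 d. Proof. exact: lt_le_trans d_long. Qed.

Lemma nc_decrease (a : R) : 0 < a -> a * (L + eta) < 3 -> decrease f eta x d a.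
Proof.
move=> a0 aL.
have aL3 : a * L < 3 by have : 0 < a * eta; [rewrite mulr_gt0|lra].
have N3 : 0 < norm2 d ^+ 3 by rewrite exprn_gt0.
have slope t : 0 <= t -> t * a * dot (G x) d <= 0.
  by move=> t_ge0; rewrite mulr_ge0_le0// mulr_ge0// ltW.
have curv t : (t * a) ^+ 2 * quad (Hs x) d <= - ((t * a) ^+ 2 * norm2 d ^+ 3).
  by rewrite -mulrN ler_wpM2l// sqr_ge0.
apply: decrease_of_model; first exact: ltW.
  apply: model_descent => t /andP[t_ge0 t_le1].
  rewrite dotZr /quad -scalemxAr dotZr dotZl norm2Z (ger0_norm (ltW a0)).
  have := slope t t_ge0; have := curv t.
  have h : (t * a) ^+ 2 * norm2 d ^+ 3 * (t * (a * L))
      <= (t * a) ^+ 2 * norm2 d ^+ 3 * 3.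
    have Q0 : 0 <= (t * a) ^+ 2 * norm2 d ^+ 3 by rewrite mulr_ge0 ?sqr_ge0 ?(ltW N3).
    rewrite (ler_wpM2l Q0)//; apply: le_trans (ltW aL3).
    by rewrite ler_piMl// mulr_ge0// ltW.
  rewrite /quad !exprMn in h *; lra.
have := slope 1 ler01; have := curv 1; rewrite !mul1r.
have h : a ^+ 2 * norm2 d ^+ 3 * (a * (L + eta)) < a ^+ 2 * norm2 d ^+ 3 * 3.
  by rewrite ltr_pM2l// mulr_gt0// exprn_gt0.
rewrite !exprMn; lra.
Qed.

Lemma nc_line_search : exists j, line_search f theta eta x d j.
Proof.
apply: (line_search_succeeds _ _ _ _ _ (1 / (L + eta)) theta01).
  by rewrite divr_gt0.
move=> b /andP[b0 bL]; apply: nc_decrease => //.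
by apply: (@le_lt_trans _ _ 1); [rewrite -ler_pdivlMr|lra].
Qed.

(** A rejected step has [b >= 3 / (L + eta)], and the accepted one is at least
    [theta] times as long. *)
Lemma nc_step (j : nat) : line_search f theta eta x d j ->
  c_nc L theta eta * eps ^+ 3 <= f x - f (x + theta ^+ j *: d).
Proof.
move=> ls; have [dec _] := ls; set a := theta ^+ j in dec *.
have a_ge : Num.min 1 (27 * theta ^+ 3 / (L + eta) ^+ 3) <= a ^+ 3.
  have [j0|[b ndec [/andP[b0 _] ab]]] := line_search_prev _ _ _ _ _ _ theta01 ls.
    by rewrite /a j0 expr0 expr1n ge_min lexx.
  rewrite ge_min; apply/orP; right.
  rewrite /a ab exprMn ler_pdivrMr ?exprn_gt0//.
  have h : 3 <= b * (L + eta).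
    by rewrite leNgt; apply: contra ndec; exact: nc_decrease.
  have : 3 ^+ 3 <= (b * (L + eta)) ^+ 3.
    by rewrite lerXn2r ?nnegrE// mulr_ge0// ltW.
  rewrite !exprMn => h'.
  have : theta ^+ 3 * 3 ^+ 3 <= theta ^+ 3 * (b ^+ 3 * (L + eta) ^+ 3).
    by rewrite ler_wpM2l// exprn_ge0// ltW.
  lra.
have eN : eps ^+ 3 <= norm2 d ^+ 3 by rewrite lerXn2r ?nnegrE ?norm2_ge0 ?(ltW eps0).
apply: le_trans (_ : eta / 6 * (a ^+ 3 * norm2 d ^+ 3) <= _); last first.
  by move: dec; rewrite /decrease; lra.
rewrite /c_nc -mulrA ler_pM2l ?divr_gt0// ler_pM ?exprn_ge0 ?(ltW eps0)//.
rewrite le_min ler01/= divr_ge0 ?mulr_ge0 ?exprn_ge0//; exact: ltW.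
Qed.

End NegativeCurvature.

Section Solution.
Context (d : 'cV[R]_n).
Let B := damped (Hs x) eps.
Hypothesis d_neq0 : d != 0.
Hypothesis d_curv : eps * norm2 d ^+ 2 <= quad B d.
Hypothesis d_slope : dot d (G x) = - quad B d.
Hypothesis d_res : norm2 (B *m d + G x) <= eps * zeta / 2 * norm2 d.

Let N0 : 0 < norm2 d. Proof. exact: norm2_gt0. Qed.
Let q := 3 * (1 - zeta) * eps / (L + eta).
Let q0 : 0 < q.
Proof. by rewrite divr_gt0// !mulr_gt0// subr_gt0. Qed.

(** Damping adds [2 eps] to the curvature. Since [d] minimizes the damped model
    along its line, at a fraction [t] of the step the undamped model has
    decreased by at least [t eps |d| ^ 2]. *)
Lemma sol_model (t : R) : 0 <= t <= 1 ->
  t * dot (G x) d + t ^+ 2 * quad (Hs x) d / 2 <= - (t * eps * norm2 d ^+ 2).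
Proof.
move=> /andP[t_ge0 t_le1]; rewrite dotC d_slope.
have e := quad_damped (Hs x) eps d; rewrite -/B in e.
have : 0 <= t * (1 - t / 2) * (quad B d - eps * norm2 d ^+ 2).
  by rewrite !mulr_ge0 ?subr_ge0//; lra.
have : 0 <= t ^+ 2 * (eps * norm2 d ^+ 2) by rewrite !mulr_ge0 ?sqr_ge0// ltW.
rewrite (_ : quad (Hs x) d = quad B d - 2 * eps * norm2 d ^+ 2); last by lra.
lra.
Qed.

Lemma sol_decrease (a : R) : 0 < a <= 1 -> a ^+ 2 * norm2 d <= q ->
  (forall t : R, 0 <= t <= 1 -> U (x + t *: (a *: d)))
  /\ decrease f eta x d a.
Proof.
move=> /andP[a0 a1] aq.
have aL : a ^+ 2 * norm2 d * (L + eta) <= 3 * eps.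
  move: aq; rewrite /q ler_pdivlMr// => /le_trans; apply.
  by rewrite mulrAC ler_piMr ?mulr_ge0 ?(ltW eps0)// gerBl ltW.
have bound t : 0 <= t <= 1 ->
    (L + eta) / 6 * (t * (a * norm2 d)) ^+ 3 <= t * a * eps * norm2 d ^+ 2 / 2.
  move=> /andP[t_ge0 t_le1].
  have h : t * a * norm2 d ^+ 2 * (a ^+ 2 * norm2 d * (L + eta))
      <= t * a * norm2 d ^+ 2 * (3 * eps).
    have Q0 : 0 <= t * a * norm2 d ^+ 2 by rewrite !mulr_ge0 ?sqr_ge0 ?norm2_ge0 ?(ltW a0).
    exact: ler_wpM2l Q0 _ _ aL.
  have : t ^+ 2 * (t * a * norm2 d ^+ 2 * (a ^+ 2 * norm2 d * (L + eta)))
      <= t * a * norm2 d ^+ 2 * (a ^+ 2 * norm2 d * (L + eta)).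
    rewrite ler_piMl ?expr_le1//.
    by rewrite !mulr_ge0 ?sqr_ge0 ?(ltW a0) ?(ltW Le0) ?(ltW N0).
  lra.
have Lbound t : 0 <= t ->
    L / 6 * (t * (a * norm2 d)) ^+ 3 <= (L + eta) / 6 * (t * (a * norm2 d)) ^+ 3.
  move=> t_ge0; rewrite ler_wpM2r// ?exprn_ge0 ?mulr_ge0 ?(ltW a0) ?(ltW N0)//.
  by rewrite ler_pM2r// lerDl ltW.
have seg t : 0 <= t <= 1 -> U (x + t *: (a *: d)).
  apply: model_descent => {}t t01; case/andP: (t01) => t_ge0 t_le1.
  have ta : 0 <= t * a <= 1 by rewrite mulr_ge0 ?(ltW a0)//= mulr_ile1// ltW.
  have := sol_model (t * a) ta; have := bound t t01; have := Lbound t t_ge0.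
  have : 0 <= t * a * eps * norm2 d ^+ 2.
    by rewrite !mulr_ge0 ?(ltW a0) ?(ltW eps0) ?norm2_ge0.
  rewrite dotZr /quad -scalemxAr dotZr dotZl norm2Z (ger0_norm (ltW a0)).
  lra.
split=> //; apply: decrease_of_model => //; first exact: ltW.
have a01 : 0 <= a <= 1 by rewrite ltW.
have o1 : 0 <= (1 : R) <= 1 by rewrite ler01 lexx.
have := sol_model a a01; have := bound 1 o1; rewrite !mul1r.
have : 0 < a * eps * norm2 d ^+ 2 by rewrite !mulr_gt0// exprn_gt0.
lra.
Qed.

Lemma sol_line_search : exists j, line_search f theta eta x d j.
Proof.
pose a := Num.min 1 (q / norm2 d).
have a0 : 0 < a by rewrite lt_min ltr01 divr_gt0.
apply: (line_search_succeeds _ _ _ _ _ a theta01 a0) => b /andP[b0].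
rewrite le_min => /andP[b1 bq].
apply: (proj2 (sol_decrease b _ _)); first by rewrite b0.
move: bq; rewrite ler_pdivlMr// => /(le_trans _); apply.
by rewrite ler_pM2r// expr2 ler_piMl// ltW.
Qed.

(** The gradient at [x + d] is the Taylor remainder, plus the residual of the
    damped Newton equation, minus the damping term [2 eps d]. *)
Lemma sol_grad_unit_step : (forall t : R, 0 <= t <= 1 -> U (x + t *: d)) ->
  norm2 (G (x + d)) <= L / 2 * norm2 d ^+ 2 + (4 + zeta) / 2 * eps * norm2 d.
Proof.
move=> seg; have := grad_taylor _ _ _ _ _ fU x d _ erefl seg L0.
set w := _ - _ - _ => hw.
have -> : G (x + d) = w + (B *m d + G x) - (2 * eps) *: d.
  rewrite /w /B /damped mulmxDl mul_scalar_mx.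
  by apply/matrixP => i j; rewrite !mxE; ring.
apply: le_trans (norm2B _ _) _; have := norm2D w (B *m d + G x).
have e20 : 0 <= 2 * eps by rewrite mulr_ge0// ltW.
rewrite norm2Z (ger0_norm e20); move: d_res hw; lra.
Qed.

(** The constant [c] solves [L c ^ 2 + (4 + zeta) c = 2], so that the bound of
    [sol_grad_unit_step] is at most [eps_g] when [|d| < c m]. *)
Lemma sol_unit_step_long (m eps_g : R) 
    (c := 4 / (Num.sqrt ((4 + zeta) ^+ 2 + 8 * L) + 4 + zeta)) :
  0 < m -> m <= eps -> m * eps <= eps_g -> eps_g < norm2 (G (x + d)) ->
  (forall t : R, 0 <= t <= 1 -> U (x + t *: d)) -> c * m <= norm2 d.
Proof.
move=> m0 me meg long seg; rewrite leNgt; apply/negP => short.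
have := sol_grad_unit_step seg.
have S0 : 0 <= (4 + zeta) ^+ 2 + 8 * L.
  by rewrite addr_ge0 ?sqr_ge0// mulr_ge0.
set S := Num.sqrt _ in c short.
have S2 : S ^+ 2 = (4 + zeta) ^+ 2 + 8 * L by rewrite sqr_sqrtr.
have S_ge0 : 0 <= S by rewrite sqrtr_ge0.
have den : 0 < S + 4 + zeta by move: z0; lra.
have c0 : 0 < c by rewrite divr_gt0.
have root : L * c ^+ 2 + (4 + zeta) * c = 2.
  have -> : L = (S ^+ 2 - (4 + zeta) ^+ 2) / 8 by lra.
  by rewrite /c; field; rewrite gt_eqF.
have h1 : norm2 d ^+ 2 <= (c * m) ^+ 2.
  have cm0 : 0 <= c * m by exact: mulr_ge0 (ltW c0) (ltW m0).
  by rewrite lerXn2r ?nnegrE ?norm2_ge0 ?(ltW short).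
have h2 : L * norm2 d ^+ 2 <= L * (c ^+ 2 * eps_g).
  rewrite ler_wpM2l//; apply: le_trans h1 _; rewrite exprMn ler_wpM2l ?sqr_ge0//.
  by apply: le_trans meg; rewrite expr2 ler_wpM2l// ltW.
have h3 : (4 + zeta) * (eps * norm2 d) <= (4 + zeta) * (c * eps_g).
  have z4 : 0 <= 4 + zeta by move: z0; lra.
  apply: (ler_wpM2l z4).
  apply: le_trans (_ : eps * (c * m) <= _).
    by rewrite ler_wpM2l// ltW.
  by rewrite mulrCA ler_wpM2l ?(ltW c0)// mulrC.
have h4 : (L * c ^+ 2 + (4 + zeta) * c) * eps_g = 2 * eps_g by rewrite root.
lra.
Qed.

(** For [|d| <= q] the unit step is accepted and [sol_unit_step_long] bounds its
    length. Otherwise the accepted step [a] satisfies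
    [a |d| >= a ^ 2 |d| >= theta ^ 2 q]. *)
Lemma sol_step (m eps_g : R) (j : nat) :
  0 < m -> m <= eps -> m * eps <= eps_g ->
  line_search f theta eta x d j -> eps_g < norm2 (G (x + theta ^+ j *: d)) ->
  c_sol L theta zeta eta * m ^+ 3 <= f x - f (x + theta ^+ j *: d).
Proof.
move=> m0 me meg ls long; have [dec lsm] := ls.
rewrite /c_sol; set A := 4 / _; set B' := 3 * theta ^+ 2 * (1 - zeta) / _.
set c := Num.min A B'.
have A0 : 0 < A.
  have := sqrtr_ge0 ((4 + zeta) ^+ 2 + 8 * L) => s0.
  by rewrite divr_gt0//; move: s0 z0; lra.
have B0 : 0 < B' by rewrite divr_gt0// !mulr_gt0 ?exprn_gt0// subr_gt0.
suff step : c * m <= theta ^+ j * norm2 d.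
  apply: le_trans (_ : eta / 6 * (theta ^+ j * norm2 d) ^+ 3 <= _); last first.
    by move: dec; rewrite /decrease exprMn; lra.
  rewrite -mulrA ler_pM2l ?divr_gt0//.
  apply: le_trans (_ : (c * m) ^+ 3 <= _); last first.
    have c0 : 0 < c by rewrite lt_min A0.
    by rewrite lerXn2r ?nnegrE ?mulr_ge0 ?norm2_ge0 ?exprn_ge0 ?(ltW t0) ?(ltW c0)
      ?(ltW m0).
  rewrite [(c * m) ^+ 3]exprMn ler_wpM2r ?exprn_ge0 ?(ltW m0)//.
  by rewrite /c; case: (leP A B') => _; rewrite ge_min lexx ?orbT.
have [Nq|qN] := leP (norm2 d) q.
  have o1 : 0 < (1 : R) <= 1 by rewrite ltr01 lexx.
  have [|seg dec1] := sol_decrease 1 o1; first by rewrite expr1n mul1r.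
  have j0 : j = 0%N.
    case: j {ls dec long} lsm => // j /(_ 0%N isT).
    by rewrite expr0 dec1.
  move: long; rewrite j0 expr0 scale1r mul1r => long.
  apply: le_trans (_ : _ * m <= _) (sol_unit_step_long m eps_g m0 me meg long _).
    by rewrite ler_wpM2r ?(ltW m0)// ge_min lexx.
  by move=> t t01; have := seg t t01; rewrite scale1r.
set a := theta ^+ j; have a0 : 0 < a by rewrite exprn_gt0.
have aq : theta ^+ 2 * q <= a ^+ 2 * norm2 d.
  have [j0|[b ndec [b01 ab]]] := line_search_prev _ _ _ _ _ _ theta01 ls.
    rewrite /a j0 expr0 expr1n mul1r; apply: le_trans (ltW qN).
    by rewrite ler_piMl ?(ltW q0)// exprn_ile1// ltW.
  rewrite /a ab exprMn -[_ * b ^+ 2 * _]mulrA ler_wpM2l ?sqr_ge0// leNgt.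
  apply: contra ndec => bq.
  exact: (proj2 (sol_decrease b b01 (ltW bq))).
apply: le_trans (_ : theta ^+ 2 * q <= _).
  apply: le_trans (_ : B' * eps <= _).
    by rewrite ler_pM ?(ltW m0)// ?ge_min ?lexx ?orbT// le_min !ltW.
  by rewrite /q /B' le_eqVlt; apply/orP; left; apply/eqP; ring.
apply: le_trans aq _; rewrite expr2 ler_pM2r// ler_piMl ?(ltW a0)//.
by rewrite /a exprn_ile1// ltW.
Qed.

End Solution.
End Steps.

(** The scaling makes the curvature along the direction equal to minus its
    length cubed, matching the cubic term of the decrease condition. *)
Lemma nc_direction {R : realType} {n : nat} (H : 'M[R]_n) (g d : 'cV[R]_n)
    (eps : R) (D := - (sgn1 (dot d g) * (`|quad H d| / norm2 d ^+ 2))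
                      *: ((norm2 d)^-1 *: d)) :
  0 < eps -> low_curv H eps d ->
  [/\ eps <= norm2 D, dot g D <= 0 & quad H D <= - norm2 D ^+ 3].
Proof.
move=> eps0 lc.
have N0 : 0 < norm2 d.
  apply: norm2_gt0; apply/eqP => d0; move: lc.
  by rewrite /low_curv /quad d0 mulmx0 dot0r norm20 expr0n mulr0 ltxx.
have := low_curv_quad _ _ _ lc; set b := quad H d; set N := norm2 d in N0 * => bN.
have b0 : b < 0.
  by apply: lt_le_trans bN _; rewrite mulNr oppr_le0 mulr_ge0 ?exprn_ge0// ltW.
pose c := `|b| / N ^+ 2.
have c_ge : eps <= c.
  rewrite /c ler_pdivlMr ?exprn_gt0// ltr0_norm//; lra.
have c0 : 0 < c by exact: lt_le_trans c_ge.
have bE : b = - c * N ^+ 2.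
  by rewrite /c mulNr divfK ?gt_eqF ?exprn_gt0// ltr0_norm// opprK.
have s1 : `|sgn1 (dot d g)| = 1.
  by rewrite /sgn1; case: ifP; rewrite ?normrN normr1.
have s2 : sgn1 (dot d g) ^+ 2 = 1.
  by rewrite -real_normK ?num_real// s1 expr1n.
have nD : norm2 D = c.
  rewrite /D !norm2Z normrN normrM s1 mul1r -/c ger0_norm ?(ltW c0)//.
  by rewrite ger0_norm ?invr_ge0 ?(ltW N0)// -/N mulVf ?mulr1 ?gt_eqF.
split; first by rewrite nD.
- rewrite /D !dotZr -/c (dotC g d) -/N.
  have : 0 <= sgn1 (dot d g) * dot d g.
    by rewrite /sgn1; case: ifPn; rewrite -?ltNge => h; lra.
  move=> h; rewrite (_ : _ * _ = - (c / N * (sgn1 (dot d g) * dot d g))); last by ring.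
  by rewrite oppr_le0 mulr_ge0//; apply: divr_ge0; exact: ltW.
rewrite nD /quad /D -!scalemxAr !dotZr !dotZl -/(quad H d) -/b -/c -/N bE.
rewrite -[c ^+ 3]mul1r -s2 le_eqVlt; apply/orP; left; apply/eqP.
by field; rewrite gt_eqF.
Qed.

(** * Iterations of the damped Newton method *)

Lemma decrease_lt {R : realType} {n : nat} (f : 'cV[R]_n -> R)
    (eta : R) (x d : 'cV[R]_n) (a : R) : 0 <= eta -> 0 <= a ->
  decrease f eta x d a -> f (x + a *: d) < f x.
Proof.
move=> eta0 a0 /lt_le_trans; apply.
by rewrite gerBl !mulr_ge0 ?exprn_ge0 ?norm2_ge0 ?invr_ge0.
Qed.

Lemma c_nc_gt0 {R : realType} (L theta eta : R) :
  0 <= L -> 0 < theta -> 0 < eta -> 0 < c_nc L theta eta.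
Proof.
move=> L0 t0 e0; have Le : 0 < L + eta by rewrite ltr_wpDl.
by rewrite mulr_gt0 ?divr_gt0// lt_min ltr01/= divr_gt0 ?mulr_gt0 ?exprn_gt0.
Qed.

Lemma c_sol_gt0 {R : realType} (L theta zeta eta : R) :
  0 <= L -> 0 < theta -> 0 < zeta < 1 -> 0 < eta -> 0 < c_sol L theta zeta eta.
Proof.
move=> L0 t0 /andP[z0 z1] e0; have Le : 0 < L + eta by rewrite ltr_wpDl.
have := sqrtr_ge0 ((4 + zeta) ^+ 2 + 8 * L) => S0.
have A0 : 0 < 4 / (Num.sqrt ((4 + zeta) ^+ 2 + 8 * L) + 4 + zeta).
  by rewrite divr_gt0//; lra.
have B0 : 0 < 3 * theta ^+ 2 * (1 - zeta) / (L + eta).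
  by rewrite divr_gt0// !mulr_gt0 ?exprn_gt0// subr_gt0.
by rewrite mulr_gt0 ?divr_gt0// lt_min !exprn_gt0.
Qed.

(** The two breakdowns of an iteration are excluded by [capped_cg_returns] and by
    the steps that [nc_decrease] and [sol_decrease] show to be accepted. *)
Lemma newton_iter_progress (R : realType) (n : nat) (f : 'cV[R]_n -> R)
    (x0 : 'cV[R]_n) (eps_g eps_H theta zeta eta : R) (M : option R)
    (U : set 'cV[R]_n) (L : R) (m : R) (x : 'cV[R]_n)
    (od ox : option 'cV[R]_n) :
  0 < eps_g -> 0 < eps_H -> 0 < theta < 1 -> 0 < zeta < 1 -> 0 < eta ->
  (forall M' : R, M = Some M' -> 0 < M') ->
  closed [set z : 'cV[R]_n | f z <= f x0] -> open U ->
  [set z : 'cV[R]_n | f z <= f x0] `<=` U -> 0 <= L ->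
  lipschitz_C2_on U L f ->
  0 < m -> m <= eps_H -> m * eps_H <= eps_g ->
  f x <= f x0 -> eps_g < norm2 (grad f x) ->
  newton_iter f eps_g eps_H theta zeta eta M x od ox ->
  exists2 x', ox = Some x' & f x' <= f x /\ (eps_g < norm2 (grad f x') ->
    Num.min (c_sol L theta zeta eta) (c_nc L theta eta) * m ^+ 3 <= f x - f x').
Proof.
move=> eg0 eH0 t01 z01 eta0 M_gt0 cl oU lU L0 fC2 m0 meH meg fx long.
have fU := lipschitz_C2_model _ _ _ fC2.
have Hsym : (hess f x)^T = hess f x.
  by apply: (trmx_hess _ _ _ _ _ fU) => //; exact: lU.
have g0 : grad f x != 0.
  by apply: contraTneq long => ->; rewrite norm20 -leNgt ltW.
have M0 : 0 <= odflt 0 M by case: M M_gt0 => //= M' /(_ _ erefl)/ltW.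
have t0 : 0 < theta by case/andP: t01.
have dirP d : newton_dir f eps_g eps_H zeta M x d ->
    (exists j, line_search f theta eta x d j) /\
    forall j, line_search f theta eta x d j ->
      eps_g < norm2 (grad f (x + theta ^+ j *: d)) ->
      Num.min (c_sol L theta zeta eta) (c_nc L theta eta) * m ^+ 3
        <= f x - f (x + theta ^+ j *: d).
  case=> [{}d _ /capped_cg_nc lc|{}d _ sol|v short]; last first.
  - by move: long; rewrite ltNge short.
  - have [d0 dc ds dr] := capped_cg_sol _ _ _ _ _ Hsym g0 eH0 z01 M0 _ sol.
    split; first exact: (sol_line_search _ _ _ _ _ _ _ _ _ _ _ fU oU lU cl fx L0 eH0
      eta0 t01 z01 d d0 dc ds).
    move=> j ls lj; have := sol_step _ _ _ _ _ _ _ _ _ _ _ fU oU lU cl fx L0 eH0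
      eta0 t01 z01 d d0 dc ds dr m eps_g j m0 meH meg ls lj.
    by apply: le_trans; rewrite ler_wpM2r ?exprn_ge0 ?(ltW m0)// ge_min lexx.
  have [dl ds dc] := nc_direction (hess f x) (grad f x) d eps_H eH0 lc.
  split; first exact: (nc_line_search _ _ _ _ _ _ _ _ _ _ fU oU lU cl fx L0 eH0
    eta0 t01 _ dl ds dc).
  move=> j ls _; have := nc_step _ _ _ _ _ _ _ _ _ _ fU oU lU cl fx L0 eH0
    eta0 t01 _ dl ds dc j ls.
  apply: le_trans; apply: ler_pM; rewrite ?exprn_ge0 ?(ltW m0)//.
  - by rewrite le_min !ltW ?c_sol_gt0 ?c_nc_gt0.
  - by rewrite ge_min lexx orbT.
  by rewrite lerXn2r ?nnegrE ?(ltW m0) ?(ltW eH0).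
case=> [short|d j dir ls|d dir nols|_ nocg].
- by move: long; rewrite ltNge short.
- exists (x + theta ^+ j *: d) => //; split; last exact: (dirP d dir).2.
  have [dec _] := ls; apply: ltW; apply: decrease_lt dec; first exact: ltW.
  by rewrite exprn_ge0// ltW.
- by have [[j ls] _] := dirP d dir; have := nols j ls.
have [d [t ret]] := capped_cg_returns (hess f x) (grad f x) eps_H zeta _
  Hsym g0 eH0 z01 M0.
by have := nocg d t ret.
Qed.

Theorem theorem3 (R : realType) (n : nat) (f : 'cV[R]_n -> R) (x0 : 'cV[R]_n)
    (eps_g eps_H theta zeta eta : R) (M : option R)
    (xs ds : nat -> option 'cV[R]_n) (U : set 'cV[R]_n) (L_H f_low : R)
    (h_eps_g : 0 < eps_g) (h_eps_H : 0 < eps_H < 1) (h_theta : 0 < theta < 1)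
    (h_zeta : 0 < zeta < 1) (h_eta : 0 < eta)
    (h_M : forall m : R, M = Some m ->
       0 < m /\ forall z : 'cV[R]_n, f z <= f x0 -> opnorm (hess f z) <= m)
    (h_compact : compact [set z : 'cV[R]_n | f z <= f x0])
    (h_run : newton_run f eps_g eps_H theta zeta eta M x0 xs ds)
    (h_open : open U)
    (h_level : [set z : 'cV[R]_n | f z <= f x0] `<=` U)
    (h_trial : forall (k : nat) (x d z : 'cV[R]_n),
       xs k = Some x -> ds k = Some d -> trial_point f theta eta x d z -> U z)
    (h_L_H : 0 <= L_H)
    (h_C2 : lipschitz_C2_on U L_H f)
    (h_low : forall z : 'cV[R]_n, f z <= f x0 -> f_low <= f z) :
  exists (k : nat) (x : 'cV[R]_n),
    [/\ (k%:Z <= K1 L_H theta zeta eta eps_g eps_H (f x0) f_low + 1)%R,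
        xs k = Some x
      & norm2 (grad f x) <= eps_g].
Proof.
apply: contrapT => none.
have eH0 : 0 < eps_H by case/andP: h_eps_H.
have t0 : 0 < theta by case/andP: h_theta.
set K := K1 _ _ _ _ _ _ _ _ in none *.
pose c := Num.min (c_sol L_H theta zeta eta) (c_nc L_H theta eta).
have c0 : 0 < c by rewrite lt_min c_sol_gt0// c_nc_gt0.
pose m := Num.min (eps_g / eps_H) eps_H.
have m0 : 0 < m by rewrite lt_min divr_gt0.
have meH : m <= eps_H by rewrite ge_min lexx orbT.
have meg : m * eps_H <= eps_g by rewrite -ler_pdivlMr// ge_min lexx.
have long k x : (k%:Z <= K + 1)%R -> xs k = Some x -> eps_g < norm2 (grad f x).
  by move=> kK xk; rewrite ltNge; apply/negP => short; apply: none; exists k, x.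
have cl : closed [set z : 'cV[R]_n | f z <= f x0].
  exact: compact_closed (@norm_hausdorff _ _) h_compact.
case: h_run => xs0 run.
have iter k : (k%:Z <= K + 1)%R -> exists2 x, xs k = Some x &
    f x <= f x0 /\ k%:R * (c * m ^+ 3) <= f x0 - f x.
  elim: k => [_|k IH kK]; first by exists x0; rewrite ?mul0r ?subrr.
  have kK' : (k%:Z <= K + 1)%R by apply: le_trans kK; rewrite lez_nat.
  have [x xk [fx dx]] := IH kK'.
  have := run k; rewrite xk => it.
  have [x' xk' [fx' dx']] := newton_iter_progress _ _ f x0 eps_g eps_H theta zeta
    eta M U L_H m x (ds k) (xs k.+1) h_eps_g eH0 h_theta h_zeta h_eta
    (fun M' e => (h_M M' e).1) cl h_open h_level h_L_H h_C2 m0 meH meg fx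
    (long k x kK' xk) it.
  exists x' => //; split; first exact: le_trans fx' fx.
  have := dx' (long k.+1 x' kK xk').
  rewrite -/c -natr1 mulrDl mul1r; lra.
(* The maximum in [K1] is [m ^ -3]. *)
have K_ge : (f x0 - f_low) <= K%:~R * (c * m ^+ 3).
  rewrite -ler_pdivrMr ?mulr_gt0 ?exprn_gt0//.
  apply: le_trans (ceil_ge _); rewrite /K /K1 -/c invfM mulrA ler_wpM2l//.
    by rewrite divr_ge0 ?(ltW c0)// subr_ge0 h_low.
  rewrite le_max /m /Num.min; case: ifP => _; apply/orP; [left|right] => //.
  by rewrite expr_div_n invf_div mulrC.
have K0 : (0 <= K)%R.
  rewrite /K /K1 ceil_ge0; apply: (@lt_le_trans _ _ 0) => //.
  rewrite mulr_ge0 ?divr_ge0 ?(ltW c0) ?subr_ge0 ?h_low//.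
  by rewrite le_max invr_ge0 exprn_ge0 ?orbT// ltW.
have [k kE] : exists k : nat, K = k%:Z by exists `|K|%N; rewrite gez0_abs.
have [|x _ [fx]] := iter k.+1; first by rewrite kE -PoszD addn1.
have := h_low x fx; move: K_ge; rewrite kE -natr1 mulrDl mul1r.
have : 0 < c * m ^+ 3 by rewrite mulr_gt0 ?exprn_gt0.
rewrite -pmulrn; lra.
Qed.
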